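(* Let $f$ be of bistable type, let $g$ be an admissible damping coefficient (both defined in the context), and let $\tau\in[0,\tau_m]$. Then there exists a unique value $c\in\mathbb{R}$, denoted $c_*=c_*(\tau)$, such that the equation $$(1-c^2\tau)U''+c\,g(U,\tau)U'+f(U)=0$$ has a monotone increasing front solution $U=U(\xi)$, $\xi\in\mathbb{R}$, with $U(-\infty)=0$ and $U(+\infty)=1$. The value $c_*(\tau)$ is related to the value $\gamma_*=\gamma_*(\tau)$ defined in the context by $$c_*=\frac{\gamma_*}{\sqrt{1+\tau\gamma_*^2}}.$$
   Context: Bistable type: $f:\mathbb{R}\to\mathbb{R}$, $f\in C^2([0,1];\mathbb{R})$, and for some $\alpha\in(0,1)$: $f(0)=f(\alpha)=f(1)=0$, $f'(0)<0$, $f'(1)<0$, $f'(\alpha)>0$, $f>0$ on $(\alpha,1)$, $f<0$ on $(0,\alpha)$. Admissible damping coefficient: for a fixed $\tau_m>0$, $g=g(u,\tau)\in C^1(\mathbb{R}\times[0,\tau_m];\mathbb{R})$ and $\inf\{g(u,\tau):u\in\mathbb{R},\ \tau\in(0,\tau_m)\}\ge\delta_0$ for some $\delta_0>0$. $\gamma_*=\gamma_*(\tau)$ denotes the unique $\gamma\in\mathbb{R}$ for which the equation $V''+\gamma\,g(V,\tau)V'+f(V)=0$ has a monotone increasing solution $V$ on $\mathbb{R}$ with $V(-\infty)=0$ and $V(+\infty)=1$ (such a unique value exists whenever $f$ is of bistable type, $g$ is an admissible damping coefficient and $\tau\in[0,\tau_m]$). *)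

(* Defs.v *)
From Stdlib Require Import Reals.
From Coquelicot Require Import Coquelicot.
Open Scope R_scope.

(* f is of class C^2 relative to D, with first and second derivatives f1, f2;
   [D_in] takes the limit inside D, so derivatives are one-sided at the
   endpoints of an interval. *)
Definition C2_on (D : R -> Prop) (f f1 f2 : R -> R) : Prop :=
  forall x, D x -> D_in f f1 D x /\ D_in f1 f2 D x /\ continue_in f2 D x.

Definition bistable (f : R -> R) : Prop :=
  exists (f1 f2 : R -> R) (alpha : R),
    C2_on (fun u => 0 <= u <= 1) f f1 f2 /\
    0 < alpha < 1 /\
    f 0 = 0 /\ f alpha = 0 /\ f 1 = 0 /\
    f1 0 < 0 /\ f1 1 < 0 /\ 0 < f1 alpha /\
    (forall u, alpha < u < 1 -> 0 < f u) /\
    (forall u, 0 < u < alpha -> f u < 0).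

Definition strip (tau_m : R) (p : R * R) : Prop := 0 <= snd p <= tau_m.

Definition continuous_on_strip (tau_m : R) (h : R -> R -> R) : Prop :=
  forall p : R * R, strip tau_m p ->
    filterlim (fun q : R * R => h (fst q) (snd q))
      (within (strip tau_m) (locally p)) (locally (h (fst p) (snd p))).

(* Class C^1 on R x [0, tau_m]: the partial derivatives (one-sided in t at
   t = 0 and t = tau_m) exist and are jointly continuous on the strip. *)
Definition C1_on_strip (tau_m : R) (g : R -> R -> R) : Prop :=
  exists gu gt : R -> R -> R,
    (forall u t, 0 <= t <= tau_m ->
       is_derive (fun v => g v t) u (gu u t) /\
       D_in (g u) (gt u) (fun s => 0 <= s <= tau_m) t) /\
    continuous_on_strip tau_m gu /\
    continuous_on_strip tau_m gt.

Definition admissible_damping (tau_m : R) (g : R -> R -> R) : Prop :=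
  C1_on_strip tau_m g /\
  exists delta0, 0 < delta0 /\
    forall u t, 0 < t < tau_m -> delta0 <= g u t.

(* U is a monotone increasing front of  a U'' + b g(U,tau) U' + f(U) = 0. *)
Definition is_front (f : R -> R) (g : R -> R -> R) (tau a b : R) (U : R -> R)
    : Prop :=
  (forall x, ex_derive U x /\ ex_derive (Derive U) x /\
     a * Derive (Derive U) x + b * g (U x) tau * Derive U x + f (U x) = 0) /\
  strict_increasing U /\
  is_lim U m_infty 0 /\ is_lim U p_infty 1.

Definition parabolic_front_speed (f : R -> R) (g : R -> R -> R)
    (tau gamma : R) : Prop :=
  exists V, is_front f g tau 1 gamma V.

Definition hyperbolic_front_speed (f : R -> R) (g : R -> R -> R)
    (tau c : R) : Prop :=
  exists U, is_front f g tau (1 - c ^ 2 * tau) c U.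

(* Definite description; by [iota_correct] it satisfies its predicate as soon
   as exactly one real number does. *)
Definition gamma_star (f : R -> R) (g : R -> R -> R) (tau : R) : R :=
  iota (parabolic_front_speed f g tau).

(* Main.v *)
Require Import Defs.
From Stdlib Require Import Reals.
From Stdlib Require Import Lra Psatz ClassicalEpsilon Ranalysis5.
From Coquelicot Require Import Coquelicot.
Open Scope R_scope.

(** If [a = 1 - c^2 tau > 0], rescaling [x] by [sqrt a] turns a front of
    [a U'' + c g(U) U' + f(U) = 0] into a front of
    [V'' + gamma g(V) V' + f(V) = 0] with [gamma = c / sqrt a], and the relation
    between [c] and [gamma] inverts to [c = gamma / sqrt (1 + tau gamma^2)]
    ([front_scale]). If [a <= 0], then [c <> 0] and there is no front: for
    [a < 0] it would be convex where [U > alpha] if [c > 0], concave where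
    [U < alpha] if [c < 0], hence unbounded; for [a = 0] the equation is
    violated at once ([front_diffusion_pos]). So the theorem reduces
    to the existence and uniqueness of the speed [gamma] of the parabolic front,
    which is proved in the phase plane, with the slope [p = V'] seen as a
    function of the height [u = V] in [(0, 1)]:
    [p p' + gamma g p + f = 0], [p 0 = p 1 = 0].

    Existence. The square [y = p^2] solves
    [y' = - 2 f - 2 gamma g sqrt y]. Up to the reflection [u -> 1 - u] the
    integral of [f] is nonpositive, and then [gamma >= 0] suffices. The
    right-hand side is merely continuous at [y = 0], but it is nonincreasing in
    [y]; hence the problem with [y 0 = 0] has a solution ([sqrt_ode_exists]),
    and its value at [1] depends continuously on [gamma]
    ([phase_solution_lip]). This value is nonnegative for [gamma = 0] and
    negative for large [gamma], so it vanishes for some [gamma]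
    ([phase_connection_exists]). Since [p] is at most linear in the distance to
    [0] and to [1] ([slope_linear_bound]), the integral of [1 / p] diverges at
    both ends, and its inverse function is a front ([front_of_phase_solution]).

    Uniqueness. The slope of a front never vanishes ([front_slope_pos]), so two
    fronts with speeds [ga1 < ga2] have slopes [P], [Q] that are functions of
    the height, and [w = P - Q] satisfies
    [w' = (ga2 - ga1) g + f w / (P Q)]. This forces [w >= 0] on [(0, alpha)],
    [w <= 0] on [(alpha, 1)] and [w' alpha > 0], which is absurd
    ([front_speed_not_lt]).

    All comparisons rest on one principle, [barrier]: a function whose
    derivative is nonpositive wherever the function is positive cannot become
    positive. *)

(** * Calculus and the barrier principle *)

Lemma is_derive_max0_sqr (w : R -> R) (x d : R) :
  is_derive w x d ->
  is_derive (fun t => Rmax 0 (w t) ^ 2) x (2 * Rmax 0 (w x) * d).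
Proof.
  intros Hw.
  assert (H : is_derive (fun t => Rmax 0 t ^ 2) (w x) (2 * Rmax 0 (w x))).
  { generalize (w x); intros t.
    apply is_derive_Reals. intros eps Heps.
    exists (mkposreal eps Heps). intros h Hh Hlt. simpl in Hlt.
    assert (Hq : Rabs (Rmax 0 (t + h) ^ 2 - Rmax 0 t ^ 2 - 2 * Rmax 0 t * h)
                 <= Rabs h * Rabs h).
    { rewrite <- Rabs_mult. rewrite (Rabs_pos_eq (h * h)) by nra.
      unfold Rmax; destruct (Rle_dec 0 (t + h)), (Rle_dec 0 t);
        apply Rabs_le; split; nra. }
    replace ((Rmax 0 (t + h) ^ 2 - Rmax 0 t ^ 2) / h - 2 * Rmax 0 t)
      with ((Rmax 0 (t + h) ^ 2 - Rmax 0 t ^ 2 - 2 * Rmax 0 t * h) / h)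
      by (field; exact Hh).
    unfold Rdiv. rewrite Rabs_mult, Rabs_inv.
    assert (0 < Rabs h) by now apply Rabs_pos_lt.
    apply Rle_lt_trans with (Rabs h); [|exact Hlt].
    apply Rmult_le_reg_r with (Rabs h); [assumption|].
    rewrite Rmult_assoc, Rinv_l by lra. lra. }
  replace (2 * Rmax 0 (w x) * d) with (scal d (2 * Rmax 0 (w x)))
    by (unfold scal; simpl; unfold mult; simpl; ring).
  exact (is_derive_comp (fun t => Rmax 0 t ^ 2) w x _ _ H Hw).
Qed.

Lemma continuous_max0_sqr (w : R -> R) (x : R) :
  continuous w x -> continuous (fun t => Rmax 0 (w t) ^ 2) x.
Proof.
  intros Hw. apply (continuous_comp w (fun t => Rmax 0 t ^ 2)); [exact Hw|].
  apply (ex_derive_continuous (fun t => Rmax 0 t ^ 2) (w x)).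
  exists (2 * Rmax 0 (w x) * 1).
  exact (is_derive_max0_sqr (fun t => t) (w x) 1 (is_derive_id (w x))).
Qed.

Lemma mean_value (w d : R -> R) (a b : R) :
  a < b ->
  (forall x, a <= x <= b -> continuous w x) ->
  (forall x, a < x < b -> is_derive w x (d x)) ->
  exists c, a < c < b /\ w b - w a = d c * (b - a).
Proof.
  intros Hab Hc Hd.
  assert (pr1 : forall c, a < c < b -> derivable_pt w c).
  { intros c Hcc. exists (d c). apply is_derive_Reals. now apply Hd. }
  assert (pr2 : forall c, a < c < b -> derivable_pt id c).
  { intros c _. apply derivable_pt_id. }
  destruct (MVT w id a b pr1 pr2 Hab) as (c & Hcc & E).
  - intros c Hcc. apply continuity_pt_filterlim. now apply Hc.
  - intros c _. apply derivable_continuous_pt, derivable_pt_id.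
  - exists c. split; [exact Hcc|].
    replace (derive_pt w c (pr1 c Hcc)) with (d c) in E.
    + replace (derive_pt id c (pr2 c Hcc)) with 1 in E.
      * unfold id in E. lra.
      * symmetry. apply derive_pt_eq_0. apply derivable_pt_lim_id.
    + symmetry. apply derive_pt_eq_0. apply is_derive_Reals. now apply Hd.
Qed.

(** A function that is nonincreasing wherever it is positive cannot become
    positive: the derivative of the square of its positive part is [<= 0]. *)
Lemma barrier (w d : R -> R) (a b : R) :
  a <= b ->
  (forall x, a <= x <= b -> continuous w x) ->
  (forall x, a < x < b -> is_derive w x (d x)) ->
  (forall x, a < x < b -> 0 < w x -> d x <= 0) ->
  w a <= 0 -> w b <= 0.
Proof.
  intros Hab Hc Hd Hn Ha.
  destruct (Req_dec a b) as [<-|Hne]; [exact Ha|].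
  destruct (mean_value (fun t => Rmax 0 (w t) ^ 2)
              (fun x => 2 * Rmax 0 (w x) * d x) a b) as (c & Hcc & E).
  - lra.
  - intros x Hx. now apply continuous_max0_sqr, Hc.
  - intros x Hx. now apply is_derive_max0_sqr, Hd.
  - destruct (Rle_lt_dec (w b) 0) as [H|H]; [exact H|exfalso].
    rewrite (Rmax_left 0 (w a)) in E by exact Ha.
    rewrite (Rmax_right 0 (w b)) in E by lra.
    assert (2 * Rmax 0 (w c) * d c <= 0).
    { destruct (Rle_lt_dec (w c) 0) as [H'|H'].
      - rewrite Rmax_left by exact H'. lra.
      - rewrite Rmax_right by lra. specialize (Hn c Hcc H'). nra. }
    nra.
Qed.

Lemma barrier_back (w d : R -> R) (a b : R) :
  a <= b ->
  (forall x, a <= x <= b -> continuous w x) ->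
  (forall x, a < x < b -> is_derive w x (d x)) ->
  (forall x, a < x < b -> 0 < w x -> 0 <= d x) ->
  w b <= 0 -> w a <= 0.
Proof.
  intros Hab Hc Hd Hn Hb.
  rewrite <- (Ropp_involutive a).
  apply (barrier (fun x => w (- x)) (fun x => - d (- x)) (- b) (- a)).
  - lra.
  - intros x Hx. apply (continuous_comp Ropp w).
    + apply (continuous_opp (fun t : R => t)), continuous_id.
    + apply Hc. lra.
  - intros x Hx.
    replace (- d (- x)) with (scal (-1) (d (- x)))
      by (unfold scal; simpl; unfold mult; simpl; ring).
    apply (is_derive_comp w Ropp).
    + apply Hd. lra.
    + auto_derive; [exact I|ring].
  - intros x Hx Hp. specialize (Hn (- x)). lra.
  - now rewrite Ropp_involutive.
Qed.

Lemma lipschitz_continuous (w : R -> R) (M x : R) :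
  (forall u v, Rabs (w u - w v) <= M * Rabs (u - v)) -> continuous w x.
Proof.
  intros H. apply continuity_pt_filterlim.
  intros eps Heps.
  assert (HM : 0 <= M).
  { specialize (H 1 0). pose proof (Rabs_pos (w 1 - w 0)).
    rewrite Rminus_0_r, Rabs_R1 in H. lra. }
  exists (eps / (M + 1)). split; [apply Rdiv_lt_0_compat; lra|].
  intros y [_ Hy]. simpl in *. unfold Rdist in *.
  apply Rle_lt_trans with (1 := H y x).
  apply Rle_lt_trans with ((M + 1) * Rabs (y - x)).
  - pose proof (Rabs_pos (y - x)). nra.
  - replace eps with ((M + 1) * (eps / (M + 1))) by (field; lra).
    apply Rmult_lt_compat_l; [lra|exact Hy].
Qed.

(** The square root is Hoelder continuous of exponent [1/2] on the whole line. *)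
Lemma sqrt_holder (a b : R) : Rabs (sqrt a - sqrt b) <= sqrt (Rabs (a - b)).
Proof.
  assert (W : forall a b, a <= b -> Rabs (sqrt a - sqrt b) <= sqrt (Rabs (a - b))).
  { clear. intros a b Hab.
    rewrite Rabs_minus_sym, Rabs_pos_eq
      by (pose proof (sqrt_le_1_alt a b Hab); lra).
    rewrite Rabs_minus_sym, Rabs_pos_eq by lra.
    destruct (Rle_lt_dec a 0) as [Ha|Ha].
    - rewrite (sqrt_neg_0 a Ha). apply Rle_trans with (sqrt b); [lra|].
      apply sqrt_le_1_alt. lra.
    - pose proof (sqrt_pos a). pose proof (sqrt_pos (b - a)).
      pose proof (sqrt_sqrt a ltac:(lra)). pose proof (sqrt_sqrt (b - a) ltac:(lra)).
      assert (sqrt b <= sqrt a + sqrt (b - a)); [|lra].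
      apply Rsqr_incr_0_var; [|lra].
      unfold Rsqr. rewrite sqrt_sqrt by lra. nra. }
  destruct (Rle_lt_dec a b) as [H|H]; [now apply W|].
  rewrite Rabs_minus_sym, (Rabs_minus_sym a). apply W. lra.
Qed.

Lemma continuous_bounded_01 (w : R -> R) :
  (forall x, continuous w x) ->
  exists M, 0 < M /\ forall x, 0 <= x <= 1 -> Rabs (w x) <= M.
Proof.
  intros Hw.
  destruct (continuity_ab_maj (fun x => Rabs (w x)) 0 1) as (m & Hm & _).
  - lra.
  - intros c _. apply continuity_pt_filterlim. apply continuous_Rabs_comp, Hw.
  - exists (Rabs (w m) + 1). split; [pose proof (Rabs_pos (w m)); lra|].
    intros x Hx. specialize (Hm x Hx). simpl in Hm. lra.
Qed.

(** The nearest point of [[0, 1]]. Precomposing with [clamp] turns a function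
    given on [[0, 1]] into one that is continuous on the whole line. *)
Definition clamp (u : R) : R := Rmax 0 (Rmin 1 u).

Lemma clamp_range (u : R) : 0 <= clamp u <= 1.
Proof.
  unfold clamp, Rmax, Rmin. repeat destruct Rle_dec; lra.
Qed.

Lemma clamp_id (u : R) : 0 <= u <= 1 -> clamp u = u.
Proof.
  intros H. unfold clamp, Rmax, Rmin. repeat destruct Rle_dec; lra.
Qed.

Lemma clamp_neg (u : R) : u <= 0 -> clamp u = 0.
Proof.
  intros H. unfold clamp, Rmax, Rmin. repeat destruct Rle_dec; lra.
Qed.

Lemma clamp_le_pos (u : R) : 0 <= u -> clamp u <= u.
Proof.
  intros H. unfold clamp, Rmax, Rmin. repeat destruct Rle_dec; lra.
Qed.

Lemma clamp_lip (u v : R) : v <= u -> 0 <= clamp u - clamp v <= u - v.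
Proof.
  intros H. unfold clamp, Rmax, Rmin. repeat destruct Rle_dec; lra.
Qed.

Lemma clamp_nonexpansive (u v : R) : Rabs (clamp u - clamp v) <= Rabs (u - v).
Proof.
  destruct (Rle_lt_dec v u) as [H|H].
  - pose proof (clamp_lip u v H). rewrite !Rabs_pos_eq; lra.
  - pose proof (clamp_lip v u ltac:(lra)).
    rewrite Rabs_minus_sym, (Rabs_minus_sym u), !Rabs_pos_eq; lra.
Qed.

Lemma RInt_clamp_lip (w : R -> R) (M u v : R) :
  (forall x, continuous w x) ->
  (forall x, 0 <= x <= 1 -> Rabs (w x) <= M) ->
  Rabs (RInt w 0 (clamp u) - RInt w 0 (clamp v)) <= M * Rabs (u - v).
Proof.
  intros Hc HM.
  assert (Hex : forall a b, ex_RInt w a b)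
    by (intros; apply (ex_RInt_continuous (V := R_CompleteNormedModule)); auto).
  assert (M0 : 0 <= M).
  { specialize (HM 0 ltac:(lra)). pose proof (Rabs_pos (w 0)). lra. }
  assert (W : forall u v, v <= u ->
    Rabs (RInt w 0 (clamp u) - RInt w 0 (clamp v)) <= M * Rabs (u - v)).
  { clear u v. intros u v Huv.
    pose proof (clamp_lip u v Huv). pose proof (clamp_range u).
    pose proof (clamp_range v).
    pose proof (RInt_Chasles w 0 (clamp v) (clamp u) (Hex _ _) (Hex _ _)) as E.
    unfold plus in E; simpl in E.
    replace (RInt w 0 (clamp u) - RInt w 0 (clamp v))
      with (RInt w (clamp v) (clamp u)) by lra.
    apply Rle_trans with ((clamp u - clamp v) * M).
    - apply abs_RInt_le_const; [lra|apply Hex|]. intros t Ht. apply HM. lra.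
    - rewrite (Rabs_pos_eq (u - v)) by lra. nra. }
  destruct (Rle_lt_dec v u) as [H|H]; [now apply W|].
  rewrite Rabs_minus_sym, (Rabs_minus_sym u). apply W. lra.
Qed.

Lemma RInt_clamp_le (w : R -> R) (M u : R) :
  (forall x, continuous w x) -> 0 <= M ->
  (forall x, 0 <= x <= 1 -> w x <= M) ->
  RInt w 0 (clamp u) <= M.
Proof.
  intros Hc M0 HM. pose proof (clamp_range u).
  apply Rle_trans with (RInt (fun _ => M) 0 (clamp u)).
  - apply RInt_le; [lra| | |].
    + apply (ex_RInt_continuous (V := R_CompleteNormedModule)); auto.
    + apply ex_RInt_const.
    + intros x Hx. apply HM. lra.
  - rewrite RInt_const. unfold scal; simpl; unfold mult; simpl. nra.
Qed.

Lemma RInt_clamp_derive (w : R -> R) (u : R) :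
  (forall x, continuous w x) -> 0 < u < 1 ->
  is_derive (fun x => RInt w 0 (clamp x)) u (w u).
Proof.
  intros Hc Hu.
  apply is_derive_ext_loc with (fun x => RInt w 0 x).
  - assert (Hd : 0 < Rmin u (1 - u)) by (apply Rmin_glb_lt; lra).
    exists (mkposreal _ Hd). intros t Ht.
    unfold ball in Ht; simpl in Ht; unfold AbsRing_ball, abs, minus, plus, opp in Ht;
      simpl in Ht.
    apply Rabs_def2 in Ht.
    pose proof (Rmin_l u (1 - u)). pose proof (Rmin_r u (1 - u)).
    rewrite clamp_id; [reflexivity|lra].
  - apply is_derive_RInt with 0; [|apply Hc].
    apply filter_forall. intros b. apply RInt_correct.
    apply (ex_RInt_continuous (V := R_CompleteNormedModule)); auto.
Qed.

(** * The Cauchy problem for y' = B - A sqrt y *)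

(** Iterates for the delayed equation
    [y' u = B u - A u * sqrt (y (u - h))], [y 0 = 0], on [[0, 1]]. Since
    [sqrt] vanishes on negative reals, no sign condition on [y] is needed. The
    [k]-th iterate is stationary on [u <= k h], see [delayed_stable]. *)
Fixpoint delayed (A B : R -> R) (h : R) (k : nat) (u : R) : R :=
  match k with
  | O => 0
  | S k => RInt (fun s => B s - A s * sqrt (delayed A B h k (s - h))) 0 (clamp u)
  end.

Lemma continuous_field (A B z : R -> R) (h x : R) :
  (forall x, continuous A x) -> (forall x, continuous B x) ->
  (forall x, continuous z x) ->
  continuous (fun s => B s - A s * sqrt (z (s - h))) x.
Proof.
  intros HA HB Hz.
  apply (continuous_minus B (fun s => A s * sqrt (z (s - h)))); [apply HB|].
  apply (continuous_mult A (fun s => sqrt (z (s - h)))); [apply HA|].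
  apply continuous_sqrt_comp.
  apply (continuous_comp (fun s => s - h) z); [|apply Hz].
  apply (continuous_minus (fun s : R => s) (fun _ => h));
    [apply continuous_id|apply continuous_const].
Qed.

Lemma delayed_continuous (A B : R -> R) (h : R) (k : nat) :
  (forall x, continuous A x) -> (forall x, continuous B x) ->
  forall x, continuous (delayed A B h k) x.
Proof.
  intros HA HB. induction k as [|k IH]; intros x; simpl.
  - apply continuous_const.
  - set (w := fun s => B s - A s * sqrt (delayed A B h k (s - h))).
    assert (Hw : forall x, continuous w x)
      by (intros; now apply continuous_field).
    destruct (continuous_bounded_01 w Hw) as (M & _ & HM).
    apply lipschitz_continuous with M. intros u v.
    now apply RInt_clamp_lip.
Qed.

Lemma delayed_le (A B : R -> R) (h MB : R) (k : nat) (u : R) :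
  (forall x, continuous A x) -> (forall x, continuous B x) ->
  (forall x, 0 <= A x) -> (forall x, 0 <= x <= 1 -> Rabs (B x) <= MB) ->
  delayed A B h k u <= MB.
Proof.
  intros HA HB A0 HM.
  assert (M0 : 0 <= MB).
  { specialize (HM 0 ltac:(lra)). pose proof (Rabs_pos (B 0)). lra. }
  destruct k as [|k]; simpl; [exact M0|].
  apply RInt_clamp_le; [|exact M0|].
  - intros x. apply continuous_field; auto. now apply delayed_continuous.
  - intros x Hx. specialize (HM x Hx). apply Rabs_le_between in HM.
    pose proof (sqrt_pos (delayed A B h k (x - h))). specialize (A0 x). nra.
Qed.

(** The iterates are bounded above by [MB], so the field is bounded although
    the square root is not. *)
Lemma delayed_field_bound (A B : R -> R) (h MA MB : R) (k : nat) (x : R) :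
  (forall x, continuous A x) -> (forall x, continuous B x) ->
  (forall x, 0 <= A x) ->
  (forall x, 0 <= x <= 1 -> Rabs (A x) <= MA) ->
  (forall x, 0 <= x <= 1 -> Rabs (B x) <= MB) ->
  0 <= x <= 1 ->
  Rabs (B x - A x * sqrt (delayed A B h k (x - h))) <= MB + MA * sqrt MB.
Proof.
  intros HA HB A0 HMA HMB Hx.
  pose proof (sqrt_le_1_alt _ _ (delayed_le A B h MB k (x - h) HA HB A0 HMB)) as H1.
  pose proof (sqrt_pos (delayed A B h k (x - h))) as H2.
  specialize (HMA x Hx). specialize (HMB x Hx). specialize (A0 x).
  apply Rabs_le_between in HMA, HMB. apply Rabs_le_between. nra.
Qed.

Lemma delayed_lip (A B : R -> R) (h MA MB : R) (k : nat) (u v : R) :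
  (forall x, continuous A x) -> (forall x, continuous B x) ->
  (forall x, 0 <= A x) ->
  (forall x, 0 <= x <= 1 -> Rabs (A x) <= MA) ->
  (forall x, 0 <= x <= 1 -> Rabs (B x) <= MB) ->
  Rabs (delayed A B h k u - delayed A B h k v)
    <= (MB + MA * sqrt MB) * Rabs (u - v).
Proof.
  intros HA HB A0 HMA HMB. destruct k as [|k].
  - simpl. rewrite Rminus_0_r, Rabs_R0.
    apply Rmult_le_pos; [|apply Rabs_pos].
    pose proof (Rabs_pos (A 0)). pose proof (Rabs_pos (B 0)).
    specialize (HMA 0 ltac:(lra)). specialize (HMB 0 ltac:(lra)).
    pose proof (sqrt_pos MB). nra.
  - simpl. apply RInt_clamp_lip.
    + intros x. apply continuous_field; auto. now apply delayed_continuous.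
    + intros x Hx. now apply delayed_field_bound.
Qed.

Lemma delayed_stable (A B : R -> R) (h : R) (k : nat) (u : R) :
  0 <= h -> u <= INR k * h ->
  delayed A B h (S k) u = delayed A B h k u.
Proof.
  intros Hh. revert u. induction k as [|k IH]; intros u Hu.
  - simpl in *. rewrite clamp_neg by lra. apply (RInt_point (V := R_CompleteNormedModule)).
  - change (delayed A B h (S (S k)) u) with
      (RInt (fun s => B s - A s * sqrt (delayed A B h (S k) (s - h))) 0 (clamp u)).
    change (delayed A B h (S k) u) with
      (RInt (fun s => B s - A s * sqrt (delayed A B h k (s - h))) 0 (clamp u)).
    apply RInt_ext. intros s Hs.
    rewrite Rmin_left, Rmax_right in Hs by apply clamp_range.
    rewrite IH; [reflexivity|].
    rewrite S_INR in Hu.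
    destruct (Rle_lt_dec u 0) as [H|H].
    + rewrite (clamp_neg u H) in Hs. lra.
    + pose proof (clamp_le_pos u). lra.
Qed.

(** The field [B - A sqrt y] is not Lipschitz at [y = 0], but it is
    nonincreasing in [y]: solutions of the delayed equations with delay tending
    to [0] are uniformly Cauchy by comparison, and their limit is a solution. *)
Lemma sqrt_ode_exists (A B : R -> R) :
  (forall x, continuous A x) -> (forall x, continuous B x) ->
  (forall x, 0 <= A x) ->
  exists y : R -> R, (forall x, continuous y x) /\ y 0 = 0 /\
    forall u, 0 < u < 1 -> is_derive y u (B u - A u * sqrt (y u)).
Proof.
  intros HA HB A0.
  destruct (continuous_bounded_01 A HA) as (MA & PA & HMA).
  destruct (continuous_bounded_01 B HB) as (MB & PB & HMB).
  set (M := MB + MA * sqrt MB).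
  assert (M0 : 0 < M) by (unfold M; pose proof (sqrt_pos MB); nra).
  pose (h := fun n => / (INR n + 1)).
  (* n + 2 iterates of step 1 / (n + 1) are stationary on the whole of [0, 1]. *)
  pose (Y := fun n u => delayed A B (h n) (S (S n)) u).
  pose (K := fun n s => B s - A s * sqrt (Y n (s - h n))).
  assert (hpos : forall n, 0 < h n).
  { intros n. unfold h. apply Rinv_0_lt_compat. pose proof (pos_INR n). lra. }
  assert (Yc : forall n x, continuous (Y n) x).
  { intros n x. now apply delayed_continuous. }
  assert (Kc : forall n x, continuous (K n) x).
  { intros n x. now apply continuous_field. }
  assert (Ylip : forall n u v, Rabs (Y n u - Y n v) <= M * Rabs (u - v)).
  { intros n u v. now apply delayed_lip. }
  assert (YK : forall n u, Y n u = RInt (K n) 0 (clamp u)).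
  { intros n u. unfold Y at 1.
    change (RInt (fun s => B s - A s * sqrt (delayed A B (h n) (S n) (s - h n)))
              0 (clamp u) = RInt (K n) 0 (clamp u)).
    apply RInt_ext. intros s Hs.
    rewrite Rmin_left, Rmax_right in Hs by apply clamp_range.
    unfold K, Y. rewrite (delayed_stable A B (h n) (S n)); [reflexivity| |].
    - specialize (hpos n). lra.
    - pose proof (clamp_range u). specialize (hpos n).
      replace (INR (S n) * h n) with 1; [lra|].
      rewrite S_INR. unfold h. field. pose proof (pos_INR n). lra. }
  assert (Y0 : forall n, Y n 0 = 0).
  { intros n. rewrite YK, clamp_neg by lra. apply (RInt_point (V := R_CompleteNormedModule)). }
  assert (Yclamp : forall n u, Y n u = Y n (clamp u)).
  { intros n u. rewrite !YK. rewrite (clamp_id (clamp u)); [reflexivity|].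
    apply clamp_range. }
  (* e n bounds the effect of the delay on the field along Y n. *)
  pose (e := fun n => MA * sqrt (M * h n)).
  assert (epos : forall n, 0 <= e n).
  { intros n. unfold e. pose proof (sqrt_pos (M * h n)). nra. }
  assert (Kerr : forall n s, 0 <= s <= 1 ->
            Rabs (K n s - (B s - A s * sqrt (Y n s))) <= e n).
  { intros n s Hs. unfold K.
    replace (B s - A s * sqrt (Y n (s - h n)) - (B s - A s * sqrt (Y n s)))
      with (A s * (sqrt (Y n s) - sqrt (Y n (s - h n)))) by ring.
    rewrite Rabs_mult. unfold e.
    apply Rmult_le_compat; try apply Rabs_pos; [now apply HMA|].
    apply Rle_trans with (1 := sqrt_holder _ _).
    apply sqrt_le_1_alt. apply Rle_trans with (1 := Ylip n _ _).
    replace (s - (s - h n)) with (h n) by ring.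
    rewrite Rabs_pos_eq; [lra|]. specialize (hpos n). lra. }
  assert (Yder : forall n u, 0 < u < 1 -> is_derive (Y n) u (K n u)).
  { intros n u Hu. apply is_derive_ext with (fun x => RInt (K n) 0 (clamp x)).
    - intros t. now rewrite YK.
    - now apply RInt_clamp_derive. }
  assert (Cmp : forall n m u, 0 <= u <= 1 -> Y n u - Y m u <= e n + e m).
  { intros n m u Hu.
    assert (Hb : Y n u - Y m u - (e n + e m) * u <= 0).
    { apply (barrier (fun u => Y n u - Y m u - (e n + e m) * u)
               (fun u => K n u - K m u - (e n + e m)) 0 u); [lra| | | |].
      - intros x _. apply (continuous_minus (fun u => Y n u - Y m u)).
        + now apply (continuous_minus (Y n) (Y m)).
        + apply (continuous_mult (fun _ => e n + e m) (fun u => u));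
            [apply continuous_const|apply continuous_id].
      - intros x Hx.
        apply (is_derive_minus (fun u => Y n u - Y m u) (fun u => (e n + e m) * u)).
        + apply (is_derive_minus (Y n) (Y m)); apply Yder; lra.
        + auto_derive; [exact I|ring].
      - intros x Hx Hp.
        pose proof (Kerr n x ltac:(lra)) as E1.
        pose proof (Kerr m x ltac:(lra)) as E2.
        apply Rabs_le_between in E1, E2.
        pose proof (epos n). pose proof (epos m).
        assert (Hs : sqrt (Y m x) <= sqrt (Y n x)) by (apply sqrt_le_1_alt; nra).
        specialize (A0 x). nra.
      - rewrite !Y0. lra. }
    pose proof (epos n). pose proof (epos m). nra. }
  assert (Cmp' : forall n m u, Rabs (Y n u - Y m u) <= e n + e m).
  { intros n m u. rewrite (Yclamp n), (Yclamp m). apply Rabs_le_between.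
    pose proof (Cmp n m _ (clamp_range u)). pose proof (Cmp m n _ (clamp_range u)).
    lra. }
  assert (h_lim : is_lim_seq h 0).
  { apply is_lim_seq_ext with (fun n => / INR (S n)).
    - intros n. unfold h. now rewrite S_INR.
    - apply (is_lim_seq_incr_1 (fun n => / INR n)).
      replace (Finite 0) with (Rbar_inv p_infty) by reflexivity.
      apply is_lim_seq_inv; [apply is_lim_seq_INR|discriminate]. }
  assert (sq_lim : forall v : nat -> R, is_lim_seq v 0 -> is_lim_seq (fun n => sqrt (v n)) 0).
  { intros v Hv. rewrite <- sqrt_0. apply is_lim_seq_continuous; [|exact Hv].
    apply continuity_pt_filterlim, continuous_sqrt. }
  assert (e_lim : is_lim_seq e 0).
  { unfold e. replace (Finite 0) with (Rbar_mult MA 0) by (simpl; f_equal; ring).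
    apply is_lim_seq_scal_l. apply sq_lim.
    replace (Finite 0) with (Rbar_mult M 0) by (simpl; f_equal; ring).
    now apply is_lim_seq_scal_l. }
  assert (Hlim : forall u, exists l : R, is_lim_seq (fun n => Y n u) l).
  { intros u. apply ex_lim_seq_cauchy_corr. intros eps.
    apply is_lim_seq_spec in e_lim.
    destruct (e_lim (pos_div_2 eps)) as (N & HN).
    exists N. intros n m Hn Hm.
    pose proof (HN n Hn) as H1. pose proof (HN m Hm) as H2. simpl in H1, H2.
    rewrite Rminus_0_r, Rabs_pos_eq in H1, H2 by apply epos.
    apply Rle_lt_trans with (1 := Cmp' n m u). lra. }
  pose (y := fun u => real (Lim_seq (fun n => Y n u))).
  assert (ylim : forall u, is_lim_seq (fun n => Y n u) (y u)).
  { intros u. destruct (Hlim u) as (l & Hl). unfold y.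
    rewrite (is_lim_seq_unique _ _ Hl). exact Hl. }
  assert (yerr : forall n u, Rabs (Y n u - y u) <= e n).
  { intros n u.
    apply (is_lim_seq_le (fun m => Rabs (Y n u - Y m u)) (fun m => e n + e m)
             (Rabs (Y n u - y u)) (e n)).
    - intros m. apply Cmp'.
    - apply (is_lim_seq_abs _ (Y n u - y u)).
      apply is_lim_seq_minus'; [apply is_lim_seq_const|apply ylim].
    - replace (Finite (e n)) with (Finite (e n + 0)) by (f_equal; ring).
      apply is_lim_seq_plus'; [apply is_lim_seq_const|exact e_lim]. }
  assert (ylip : forall u v, Rabs (y u - y v) <= M * Rabs (u - v)).
  { intros u v.
    apply (is_lim_seq_le (fun m => Rabs (Y m u - Y m v)) (fun m => M * Rabs (u - v))
             (Rabs (y u - y v)) (M * Rabs (u - v))).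
    - intros m. apply Ylip.
    - apply (is_lim_seq_abs _ (y u - y v)). apply is_lim_seq_minus'; apply ylim.
    - apply is_lim_seq_const. }
  assert (yc : forall x, continuous y x).
  { intros x. now apply lipschitz_continuous with M. }
  pose (k := fun s => B s - A s * sqrt (y s)).
  assert (kc : forall x, continuous k x).
  { intros x. apply (continuous_ext (fun s => B s - A s * sqrt (y (s - 0)))).
    - intros s. now rewrite Rminus_0_r.
    - now apply continuous_field. }
  assert (yint : forall u, y u = RInt k 0 (clamp u)).
  { intros u. pose proof (clamp_range u) as Hcu.
    assert (Hex : forall w : R -> R, (forall x, continuous w x) -> forall a b, ex_RInt w a b)
      by (intros; apply (ex_RInt_continuous (V := R_CompleteNormedModule)); auto).
    assert (L : is_lim_seq (fun n => Y n u) (RInt k 0 (clamp u))).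
    { apply is_lim_seq_le_le_loc with
        (u := fun n => RInt k 0 (clamp u) - (e n + MA * sqrt (e n)))
        (w := fun n => RInt k 0 (clamp u) + (e n + MA * sqrt (e n))).
      - apply filter_forall. intros n.
        assert (Hd : Rabs (RInt (fun s => K n s - k s) 0 (clamp u))
                       <= (clamp u - 0) * (e n + MA * sqrt (e n))).
        { apply abs_RInt_le_const; [lra| |].
          - apply Hex. intros x. now apply (continuous_minus (K n) k).
          - intros s Hs.
            replace (K n s - k s) with
              ((K n s - (B s - A s * sqrt (Y n s))) + A s * (sqrt (y s) - sqrt (Y n s)))
              by (unfold k; ring).
            apply Rle_trans with (1 := Rabs_triang _ _).
            apply Rplus_le_compat; [apply Kerr; lra|].
            rewrite Rabs_mult. apply Rmult_le_compat; try apply Rabs_pos.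
            + apply HMA. lra.
            + apply Rle_trans with (1 := sqrt_holder _ _).
              apply sqrt_le_1_alt. rewrite Rabs_minus_sym. apply yerr. }
        pose proof (RInt_minus (K n) k 0 (clamp u) (Hex _ (Kc n) _ _) (Hex _ kc _ _)) as E.
        unfold minus, plus, opp in E; simpl in E.
        change (RInt (fun s => K n s - k s) 0 (clamp u)
                 = RInt (K n) 0 (clamp u) + - RInt k 0 (clamp u)) in E.
        rewrite E, <- YK in Hd. apply Rabs_le_between in Hd.
        pose proof (epos n). pose proof (sqrt_pos (e n)).
        assert (0 <= e n + MA * sqrt (e n)) by nra.
        split; nra.
      - replace (Finite (RInt k 0 (clamp u)))
          with (Finite (RInt k 0 (clamp u) - (0 + MA * 0))) by (f_equal; ring).
        apply is_lim_seq_minus'; [apply is_lim_seq_const|].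
        apply is_lim_seq_plus'; [exact e_lim|].
        apply (is_lim_seq_scal_l (fun n => sqrt (e n)) MA 0). now apply sq_lim.
      - replace (Finite (RInt k 0 (clamp u)))
          with (Finite (RInt k 0 (clamp u) + (0 + MA * 0))) by (f_equal; ring).
        apply is_lim_seq_plus'; [apply is_lim_seq_const|].
        apply is_lim_seq_plus'; [exact e_lim|].
        apply (is_lim_seq_scal_l (fun n => sqrt (e n)) MA 0). now apply sq_lim. }
    pose proof (is_lim_seq_unique _ _ L) as E1.
    pose proof (is_lim_seq_unique _ _ (ylim u)) as E2.
    rewrite E1 in E2. now injection E2. }
  exists y. split; [exact yc|split].
  - rewrite yint, clamp_neg by lra. apply (RInt_point (V := R_CompleteNormedModule)).
  - intros u Hu. apply is_derive_ext with (fun x => RInt k 0 (clamp x)).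
    + intros t. now rewrite yint.
    + exact (RInt_clamp_derive k u kc Hu).
Qed.

(** * Shooting in the phase plane *)

Lemma continuous_sub (v w : R -> R) (x : R) :
  continuous v x -> continuous w x -> continuous (fun t => v t - w t) x.
Proof. intros. now apply (continuous_minus v w). Qed.

Lemma continuous_add (v w : R -> R) (x : R) :
  continuous v x -> continuous w x -> continuous (fun t => v t + w t) x.
Proof. intros. now apply (continuous_plus v w). Qed.

Lemma continuous_mul (v w : R -> R) (x : R) :
  continuous v x -> continuous w x -> continuous (fun t => v t * w t) x.
Proof. intros. now apply (continuous_mult v w). Qed.

Lemma is_derive_sub (v w : R -> R) (x a b : R) :
  is_derive v x a -> is_derive w x b -> is_derive (fun t => v t - w t) x (a - b).
Proof. intros. now apply (is_derive_minus v w). Qed.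

Lemma is_derive_cst (c x : R) : is_derive (fun _ : R => c) x 0.
Proof. exact (is_derive_const c x). Qed.

Lemma is_derive_primitive (w : R -> R) (a x : R) :
  (forall t, continuous w t) -> is_derive (fun t => RInt w a t) x (w x).
Proof.
  intros Hw. apply is_derive_RInt with a; [|apply Hw].
  apply filter_forall. intros b. apply RInt_correct.
  apply (ex_RInt_continuous (V := R_CompleteNormedModule)); auto.
Qed.

(** [y] solves the phase-plane equation [y' = - 2 gamma g sqrt y - 2 f],
    [y 0 = 0], satisfied by the square [y] of the slope of a front, seen as a
    function of the height of the front. *)
Definition phase_solution (f g : R -> R) (gamma : R) (y : R -> R) : Prop :=
  (forall x, continuous y x) /\ y 0 = 0 /\
  forall u, 0 < u < 1 ->
    is_derive y u (- 2 * f u - 2 * gamma * g u * sqrt (y u)).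

Lemma phase_solution_exists (f g : R -> R) (gamma : R) :
  (forall x, continuous f x) -> (forall x, continuous g x) ->
  (forall x, 0 <= g x) -> 0 <= gamma ->
  exists y, phase_solution f g gamma y.
Proof.
  intros Hf Hg Hg0 Hga.
  apply (sqrt_ode_exists (fun u => 2 * gamma * g u) (fun u => - 2 * f u)).
  - intros x. apply continuous_mul; [apply continuous_const|apply Hg].
  - intros x. apply continuous_mul; [apply continuous_const|apply Hf].
  - intros x. specialize (Hg0 x). nra.
Qed.

Lemma phase_solution_le (f g : R -> R) (gamma M u : R) (y : R -> R) :
  (forall x, 0 <= g x) -> 0 <= gamma ->
  (forall x, 0 <= x <= 1 -> Rabs (f x) <= M) ->
  phase_solution f g gamma y -> 0 <= u <= 1 -> y u <= 2 * M.
Proof.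
  intros Hg0 Hga HM (Hc & H0 & Hd) Hu.
  assert (M0 : 0 <= M).
  { specialize (HM 0 ltac:(lra)). pose proof (Rabs_pos (f 0)). lra. }
  assert (H : y u - 2 * M * u <= 0); [|nra].
  apply (barrier (fun u => y u - 2 * M * u)
           (fun u => - 2 * f u - 2 * gamma * g u * sqrt (y u) - 2 * M) 0 u).
  - lra.
  - intros x _. apply continuous_sub; [apply Hc|].
    apply continuous_mul; [apply continuous_const|apply continuous_id].
  - intros x Hx. apply is_derive_sub; [apply Hd; lra|].
    auto_derive; [exact I|ring].
  - intros x Hx _. specialize (HM x ltac:(lra)). apply Rabs_le_between in HM.
    pose proof (sqrt_pos (y x)). specialize (Hg0 x).
    assert (0 <= gamma * g x * sqrt (y x)) by (repeat apply Rmult_le_pos; lra).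
    lra.
  - lra.
Qed.

(** Continuous dependence on [gamma] of the terminal value: the field being
    nonincreasing in [y], no Gronwall factor appears. *)
Lemma phase_solution_lip (f g : R -> R) (ga1 ga2 Mf Mg : R) (y1 y2 : R -> R) :
  (forall x, 0 <= g x) -> 0 <= ga1 -> 0 <= ga2 ->
  (forall x, 0 <= x <= 1 -> Rabs (f x) <= Mf) ->
  (forall x, 0 <= x <= 1 -> Rabs (g x) <= Mg) ->
  phase_solution f g ga1 y1 -> phase_solution f g ga2 y2 ->
  y1 1 - y2 1 <= 2 * Mg * sqrt (2 * Mf) * Rabs (ga1 - ga2).
Proof.
  intros Hg0 Hg1 Hg2 HMf HMg S1 S2.
  pose proof (fun u => phase_solution_le f g ga2 Mf u y2 Hg0 Hg2 HMf S2) as B2.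
  destruct S1 as (c1 & z1 & d1). destruct S2 as (c2 & z2 & d2).
  set (L := 2 * Mg * sqrt (2 * Mf) * Rabs (ga1 - ga2)).
  assert (H : y1 1 - y2 1 - L * 1 <= 0); [|lra].
  apply (barrier (fun u => y1 u - y2 u - L * u)
           (fun u => (- 2 * f u - 2 * ga1 * g u * sqrt (y1 u))
                     - (- 2 * f u - 2 * ga2 * g u * sqrt (y2 u)) - L) 0 1).
  - lra.
  - intros x _. apply continuous_sub; [now apply continuous_sub|].
    apply continuous_mul; [apply continuous_const|apply continuous_id].
  - intros x Hx. apply is_derive_sub; [now apply is_derive_sub; auto|].
    auto_derive; [exact I|ring].
  - intros x Hx Hp.
    assert (L0 : 0 <= L).
    { unfold L. specialize (HMg 0 ltac:(lra)). pose proof (Rabs_pos (g 0)).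
      pose proof (sqrt_pos (2 * Mf)). pose proof (Rabs_pos (ga1 - ga2)).
      repeat apply Rmult_le_pos; lra. }
    assert (H1 : sqrt (y2 x) <= sqrt (y1 x)) by (apply sqrt_le_1_alt; nra).
    assert (H2 : sqrt (y2 x) <= sqrt (2 * Mf)) by (apply sqrt_le_1_alt, B2; lra).
    pose proof (sqrt_pos (y2 x)) as H3.
    specialize (HMg x ltac:(lra)). specialize (Hg0 x).
    rewrite Rabs_pos_eq in HMg by exact Hg0.
    assert (H4 : ga1 * g x * sqrt (y2 x) <= ga1 * g x * sqrt (y1 x))
      by (apply Rmult_le_compat_l; [now apply Rmult_le_pos|exact H1]).
    assert (H5 : (ga2 - ga1) * (g x * sqrt (y2 x))
                 <= Rabs (ga1 - ga2) * (Mg * sqrt (2 * Mf))).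
    { apply Rle_trans with (Rabs (ga1 - ga2) * (g x * sqrt (y2 x))).
      - apply Rmult_le_compat_r; [now apply Rmult_le_pos|].
        rewrite Rabs_minus_sym. apply Rle_abs.
      - apply Rmult_le_compat_l; [apply Rabs_pos|].
        apply Rmult_le_compat; lra. }
    unfold L. lra.
  - lra.
Qed.

(** Strong damping keeps [y alpha] below the integral [I] of [f] over
    [[alpha, 1]], and [y] then decreases by at least [2 I]. *)
Lemma phase_solution_large (f g : R -> R) (alpha delta : R) :
  (forall x, continuous f x) ->
  0 < delta -> (forall x, delta <= g x) ->
  0 < alpha < 1 -> (forall u, alpha < u < 1 -> 0 < f u) ->
  exists gamma, 0 < gamma /\
    forall y, phase_solution f g gamma y -> y 1 < 0.
Proof.
  intros Hf Hde Hg Hal Hpos.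
  destruct (continuous_bounded_01 f Hf) as (M & PM & HM).
  assert (PI : 0 < RInt f alpha 1).
  { apply RInt_gt_0; [lra|exact Hpos|]. intros x _. apply Hf. }
  set (I := RInt f alpha 1) in *.
  assert (Psq : 0 < sqrt I) by now apply sqrt_lt_R0.
  (* Above the level I, the damping with this gamma outweighs 2 |f|. *)
  exists (M / (delta * sqrt I)).
  set (gamma := M / (delta * sqrt I)).
  assert (Pga : 0 < gamma) by (apply Rdiv_lt_0_compat; nra).
  assert (Ega : gamma * delta * sqrt I = M) by (unfold gamma; field; lra).
  split; [exact Pga|]. clearbody gamma. intros y (Hc & H0 & Hd).
  assert (H1 : y alpha - I <= 0).
  { apply (barrier (fun u => y u - I)
             (fun u => - 2 * f u - 2 * gamma * g u * sqrt (y u) - 0) 0 alpha).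
    - lra.
    - intros x _. apply continuous_sub; [apply Hc|apply continuous_const].
    - intros x Hx. apply is_derive_sub; [apply Hd; lra|apply is_derive_cst].
    - intros x Hx Hp. specialize (HM x ltac:(lra)). apply Rabs_le_between in HM.
      assert (Hs : sqrt I <= sqrt (y x)) by (apply sqrt_le_1_alt; lra).
      assert (gamma * delta * sqrt I <= gamma * g x * sqrt (y x)).
      { apply Rmult_le_compat; try nra. apply Rmult_le_compat_l; [lra|apply Hg]. }
      lra.
    - lra. }
  assert (H2 : y 1 + 2 * RInt f alpha 1 - I <= 0).
  { apply (barrier (fun u => y u + 2 * RInt f alpha u - I)
             (fun u => (- 2 * f u - 2 * gamma * g u * sqrt (y u)) + 2 * f u - 0) alpha 1).
    - lra.
    - intros x _. apply continuous_sub; [|apply continuous_const].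
      apply continuous_add; [apply Hc|].
      apply continuous_mul; [apply continuous_const|].
      apply (ex_derive_continuous (fun t => RInt f alpha t)).
      exists (f x). now apply is_derive_primitive.
    - intros x Hx. apply is_derive_sub; [|apply is_derive_cst].
      apply (is_derive_plus y (fun t => 2 * RInt f alpha t)); [apply Hd; lra|].
      apply (is_derive_scal (fun t => RInt f alpha t)).
      now apply is_derive_primitive.
    - intros x Hx _. pose proof (sqrt_pos (y x)). specialize (Hg x).
      assert (0 <= gamma * g x * sqrt (y x)) by (repeat apply Rmult_le_pos; lra).
      lra.
    - replace (RInt f alpha alpha) with 0
        by (symmetry; apply (RInt_point (V := R_CompleteNormedModule))).
      lra. }
  fold I in H2. lra.
Qed.

Lemma phase_solution_zero (f g : R -> R) (y : R -> R) :
  (forall x, continuous f x) -> RInt f 0 1 <= 0 ->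
  phase_solution f g 0 y -> 0 <= y 1.
Proof.
  intros Hf HI (Hc & H0 & Hd).
  assert (H : - (y 1 + 2 * RInt f 0 1) <= 0); [|lra].
  apply (barrier (fun u => - (y u + 2 * RInt f 0 u))
           (fun u => - ((- 2 * f u - 2 * 0 * g u * sqrt (y u)) + 2 * f u)) 0 1).
  - lra.
  - intros x _. apply (continuous_opp (fun u => y u + 2 * RInt f 0 u)).
    apply continuous_add; [apply Hc|].
    apply continuous_mul; [apply continuous_const|].
    apply (ex_derive_continuous (fun t => RInt f 0 t)).
    exists (f x). now apply is_derive_primitive.
  - intros x Hx. apply (is_derive_opp (fun u => y u + 2 * RInt f 0 u)).
    apply (is_derive_plus y (fun t => 2 * RInt f 0 t)); [now apply Hd|].
    apply (is_derive_scal (fun t => RInt f 0 t)).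
    now apply is_derive_primitive.
  - intros x Hx _. lra.
  - replace (RInt f 0 0) with 0
      by (symmetry; apply (RInt_point (V := R_CompleteNormedModule))).
    lra.
Qed.

(** Once [y] returns to [0] at [1] it is positive in between: on [(0, alpha)]
    because [f < 0] pushes it up, on [[alpha, 1)] because it is decreasing on
    [(alpha, 1)] towards [0]. *)
Lemma phase_solution_pos (f g : R -> R) (alpha gamma : R) (y : R -> R) :
  (forall x, 0 <= g x) -> 0 <= gamma -> 0 < alpha < 1 ->
  (forall u, 0 < u < alpha -> f u < 0) -> (forall u, alpha < u < 1 -> 0 < f u) ->
  phase_solution f g gamma y -> y 1 = 0 ->
  forall u, 0 < u < 1 -> 0 < y u.
Proof.
  intros Hg Hga Hal Hneg Hpos (Hc & H0 & Hd) H1 u Hu.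
  destruct (Rlt_le_dec u alpha) as [Hua|Hua].
  - assert (N : forall x, 0 <= x <= alpha -> 0 <= y x).
    { intros x Hx. assert (H : - y x <= 0); [|lra].
      apply (barrier (fun u => - y u)
               (fun u => - (- 2 * f u - 2 * gamma * g u * sqrt (y u))) 0 x).
      - lra.
      - intros t _. now apply (continuous_opp y).
      - intros t Ht. apply (is_derive_opp y). apply Hd. lra.
      - intros t Ht Hp. rewrite sqrt_neg_0 by lra. specialize (Hneg t). lra.
      - lra. }
    destruct (N u ltac:(lra)) as [H|H]; [exact H|exfalso].
    (* u would be an interior minimum of y although y' u = - 2 f u > 0. *)
    pose proof (Hd u Hu) as D. rewrite <- H, sqrt_0 in D.
    apply is_derive_Reals in D.
    pose proof (derive_pt_eq_0 y u _ (exist _ _ D) D) as E.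
    rewrite (deriv_minimum y 0 alpha u) in E; [|lra|lra|].
    + specialize (Hneg u ltac:(lra)). lra.
    + intros x Hx0 Hxa. rewrite <- H. apply N. lra.
  - destruct (mean_value y (fun u => - 2 * f u - 2 * gamma * g u * sqrt (y u)) u 1)
      as (c & Hcc & E).
    + lra.
    + intros x _. apply Hc.
    + intros x Hx. apply Hd. lra.
    + specialize (Hpos c ltac:(lra)). pose proof (sqrt_pos (y c)).
      assert (0 <= gamma * g c * sqrt (y c))
        by (repeat apply Rmult_le_pos; try lra; apply Hg).
      nra.
Qed.

(** Shooting: the terminal value depends continuously on [gamma >= 0], is
    nonnegative for [gamma = 0] and negative for large [gamma]. *)
Lemma phase_connection_exists (f g : R -> R) (alpha delta : R) :
  (forall x, continuous f x) -> (forall x, continuous g x) ->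
  0 < delta -> (forall x, delta <= g x) -> 0 < alpha < 1 ->
  (forall u, 0 < u < alpha -> f u < 0) -> (forall u, alpha < u < 1 -> 0 < f u) ->
  RInt f 0 1 <= 0 ->
  exists gamma y, phase_solution f g gamma y /\ y 1 = 0 /\
    forall u, 0 < u < 1 -> 0 < y u.
Proof.
  intros Hf Hg Hde Hgd Hal Hneg Hpos HI.
  assert (Hg0 : forall x, 0 <= g x) by (intros x; specialize (Hgd x); lra).
  (* The parameter Rabs ga makes the shooting map total and continuous on R. *)
  assert (S : forall ga, {y | phase_solution f g (Rabs ga) y}).
  { intros ga. apply constructive_indefinite_description.
    apply phase_solution_exists; auto. apply Rabs_pos. }
  pose (Y := fun ga => proj1_sig (S ga) 1).
  destruct (continuous_bounded_01 f Hf) as (Mf & _ & HMf).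
  destruct (continuous_bounded_01 g Hg) as (Mg & PMg & HMg).
  set (L := 2 * Mg * sqrt (2 * Mf)).
  assert (L0 : 0 <= L) by (unfold L; pose proof (sqrt_pos (2 * Mf)); nra).
  assert (Ylip1 : forall a b, Y a - Y b <= L * Rabs (a - b)).
  { intros a b. unfold Y.
    apply Rle_trans with (L * Rabs (Rabs a - Rabs b)).
    - apply (phase_solution_lip f g (Rabs a) (Rabs b) Mf Mg); auto using Rabs_pos;
        apply proj2_sig.
    - apply Rmult_le_compat_l; [exact L0|]. apply Rabs_triang_inv2. }
  assert (Ylip : forall a b, Rabs (Y a - Y b) <= L * Rabs (a - b)).
  { intros a b. apply Rabs_le_between.
    pose proof (Ylip1 a b). pose proof (Ylip1 b a) as H'.
    rewrite Rabs_minus_sym in H'. lra. }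
  destruct (phase_solution_large f g alpha delta Hf Hde Hgd Hal Hpos) as (G & PG & HG).
  assert (YG : Y G < 0).
  { unfold Y. apply HG. rewrite <- (Rabs_pos_eq G) at 1 by lra. apply proj2_sig. }
  assert (Y0 : 0 <= Y 0).
  { unfold Y. apply (phase_solution_zero f g); auto.
    rewrite <- Rabs_R0 at 1. apply proj2_sig. }
  destruct (IVT_gen Y 0 G 0) as (ga & _ & Ega).
  - intros x. apply continuity_pt_filterlim. now apply lipschitz_continuous with L.
  - rewrite Rmin_right, Rmax_left by lra. lra.
  - exists (Rabs ga), (proj1_sig (S ga)).
    split; [apply proj2_sig|split; [exact Ega|]].
    apply (phase_solution_pos f g alpha (Rabs ga)); auto using Rabs_pos.
    apply proj2_sig.
Qed.

(** * Derivative of an inverse function *)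

Lemma inverse_increasing (D E : R -> Prop) (h k : R -> R) :
  (forall y, E y -> D (k y) /\ h (k y) = y) ->
  (forall x x', D x -> D x' -> x < x' -> h x < h x') ->
  forall y y', E y -> E y' -> y < y' -> k y < k y'.
Proof.
  intros HE Hinc y y' Ey Ey' Hy.
  destruct (HE y Ey) as [D1 H1]. destruct (HE y' Ey') as [D2 H2].
  destruct (Rlt_le_dec (k y) (k y')) as [H|H]; [exact H|exfalso].
  destruct H as [H|H].
  - pose proof (Hinc _ _ D2 D1 H). lra.
  - rewrite H in H2. lra.
Qed.

(** [h] maps [D] increasingly onto [E], with inverse [k], and [k y], [y] are
    interior points; continuity of [k] is a consequence and need not be
    assumed. *)
Lemma is_derive_inverse (D E : R -> Prop) (h k : R -> R) (y l : R) :
  (forall x, D x -> E (h x) /\ k (h x) = x) ->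
  (forall y, E y -> D (k y) /\ h (k y) = y) ->
  (forall x x', D x -> D x' -> x < x' -> h x < h x') ->
  locally (k y) D -> locally y E -> E y ->
  is_derive h (k y) l -> l <> 0 -> is_derive k y (/ l).
Proof.
  intros HD HE Hinc [r Hr] [r' Hr'] Ey Hh Hl.
  assert (BD : forall t, Rabs t < r -> D (k y + t)).
  { intros t Ht. apply Hr. unfold ball; simpl. unfold AbsRing_ball, abs, minus, plus, opp; simpl.
    now replace (k y + t + - k y) with t by ring. }
  assert (BE : forall t, Rabs t < r' -> E (y + t)).
  { intros t Ht. apply Hr'. unfold ball; simpl. unfold AbsRing_ball, abs, minus, plus, opp; simpl.
    now replace (y + t + - y) with t by ring. }
  pose proof (inverse_increasing D E h k HE Hinc) as Kinc.
  assert (Kc : forall eps, 0 < eps -> exists rho, 0 < rho /\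
             forall t, Rabs t < rho -> E (y + t) /\ Rabs (k (y + t) - k y) < eps).
  { intros eps Heps.
    pose proof (cond_pos r) as Pr. pose proof (cond_pos r') as Pr'.
    set (e := Rmin eps r / 2).
    pose proof (Rmin_l eps r) as M1. pose proof (Rmin_r eps r) as M2.
    assert (Pe : 0 < e) by (unfold e; assert (0 < Rmin eps r) by (now apply Rmin_glb_lt); lra).
    assert (Dp : D (k y + e)) by (apply BD; rewrite Rabs_pos_eq; unfold e in *; lra).
    assert (Dm : D (k y + - e))
      by (apply BD; rewrite Rabs_Ropp, Rabs_pos_eq; unfold e in *; lra).
    destruct (HE y Ey) as [Dy hky].
    pose proof (Hinc _ _ Dm Dy ltac:(lra)) as I1.
    pose proof (Hinc _ _ Dy Dp ltac:(lra)) as I2.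
    rewrite hky in I1, I2.
    destruct (HD _ Dp) as [Ep Kp]. destruct (HD _ Dm) as [Em Km].
    exists (Rmin r' (Rmin (y - h (k y + - e)) (h (k y + e) - y))).
    split; [repeat apply Rmin_glb_lt; lra|].
    intros t Ht.
    pose proof (Rmin_l r' (Rmin (y - h (k y + - e)) (h (k y + e) - y))).
    pose proof (Rmin_r r' (Rmin (y - h (k y + - e)) (h (k y + e) - y))).
    pose proof (Rmin_l (y - h (k y + - e)) (h (k y + e) - y)).
    pose proof (Rmin_r (y - h (k y + - e)) (h (k y + e) - y)).
    assert (Et : E (y + t)) by (apply BE; lra).
    split; [exact Et|].
    assert (Ht' : Rabs t < Rmin (y - h (k y + - e)) (h (k y + e) - y)) by lra.
    apply Rabs_def2 in Ht'.
    pose proof (Kinc _ _ Et Ep ltac:(lra)) as J1. rewrite Kp in J1.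
    pose proof (Kinc _ _ Em Et ltac:(lra)) as J2. rewrite Km in J2.
    apply Rabs_def1; unfold e in *; lra. }
  apply is_derive_Reals in Hh. apply is_derive_Reals.
  intros eps Heps.
  assert (Pl : 0 < Rabs l) by now apply Rabs_pos_lt.
  (* |q - l| < eta gives |q| > |l| / 2, hence |1/q - 1/l| < 2 eta / |l|^2. *)
  set (eta := Rmin (Rabs l / 2) (eps * (Rabs l * Rabs l) / 2)).
  assert (Peta : 0 < eta) by (apply Rmin_glb_lt; [lra|assert (0 < Rabs l * Rabs l) by nra; nra]).
  destruct (Hh eta Peta) as (dl & Hdl).
  destruct (Kc dl (cond_pos dl)) as (rho & Prho & Hrho).
  exists (mkposreal rho Prho). intros s Hs Hlt. simpl in Hlt.
  destruct (Hrho s Hlt) as [Es Ks].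
  destruct (HE _ Es) as [Ds hks]. destruct (HE y Ey) as [Dy hky].
  set (t := k (y + s) - k y) in *.
  assert (Ht : t <> 0).
  { intros H0. assert (k (y + s) = k y) by (unfold t in H0; lra).
    rewrite H, hky in hks. lra. }
  specialize (Hdl t Ht Ks).
  replace (k y + t) with (k (y + s)) in Hdl by (unfold t; ring).
  rewrite hks, hky in Hdl. replace (y + s - y) with s in Hdl by ring.
  set (q := s / t) in *.
  assert (Hq : t / s = / q) by (unfold q; field; auto).
  rewrite Hq.
  pose proof (Rmin_l (Rabs l / 2) (eps * (Rabs l * Rabs l) / 2)) as N1.
  pose proof (Rmin_r (Rabs l / 2) (eps * (Rabs l * Rabs l) / 2)) as N2.
  fold eta in N1, N2.
  assert (Pq : Rabs l / 2 < Rabs q).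
  { pose proof (Rabs_triang_inv l (l - q)) as J.
    replace (l - (l - q)) with q in J by ring.
    rewrite (Rabs_minus_sym l q) in J. lra. }
  assert (q <> 0) by (intros H0; rewrite H0, Rabs_R0 in Pq; lra).
  replace (/ q - / l) with ((l - q) / (q * l)) by (field; auto).
  unfold Rdiv. rewrite Rabs_mult, Rabs_inv, Rabs_mult, Rabs_minus_sym.
  apply Rmult_lt_reg_r with (Rabs q * Rabs l); [nra|].
  rewrite Rmult_assoc, Rinv_l by nra.
  assert (Rabs l / 2 * Rabs l <= Rabs q * Rabs l) by nra.
  nra.
Qed.

(** * Fronts and their symmetries *)

(** [U] is a monotone increasing front of [a U'' + b g(U) U' + f(U) = 0], with
    [U1] and [U2] its first and second derivatives. *)
Definition front (f g : R -> R) (a b : R) (U U1 U2 : R -> R) : Prop :=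
  (forall x, is_derive U x (U1 x)) /\ (forall x, is_derive U1 x (U2 x)) /\
  (forall x, a * U2 x + b * g (U x) * U1 x + f (U x) = 0) /\
  strict_increasing U /\ is_lim U m_infty 0 /\ is_lim U p_infty 1.

Lemma is_front_front (f : R -> R) (g : R -> R -> R) (tau a b : R) (U : R -> R) :
  is_front f g tau a b U ->
  front f (fun u => g u tau) a b U (Derive U) (Derive (Derive U)).
Proof.
  intros (H & Hi & L0 & L1).
  refine (conj _ (conj _ (conj _ (conj _ (conj _ _))))); auto.
  - intros x. apply Derive_correct, H.
  - intros x. apply Derive_correct, H.
  - intros x. apply H.
Qed.

Lemma front_is_front (f : R -> R) (g : R -> R -> R) (tau a b : R) (U U1 U2 : R -> R) :
  front f (fun u => g u tau) a b U U1 U2 -> is_front f g tau a b U.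
Proof.
  intros (H1 & H2 & He & Hi & L0 & L1). split; [|auto].
  assert (E1 : forall x, Derive U x = U1 x)
    by (intros x; apply is_derive_unique, H1).
  assert (D2 : forall x, is_derive (Derive U) x (U2 x)).
  { intros x. apply is_derive_ext with U1; [intros t; now rewrite E1|apply H2]. }
  intros x. split; [eexists; apply H1|split; [eexists; apply D2|]].
  rewrite E1, (is_derive_unique _ _ _ (D2 x)). apply He.
Qed.

Lemma front_range (f g : R -> R) (a b : R) (U U1 U2 : R -> R) :
  front f g a b U U1 U2 -> forall x, 0 < U x < 1.
Proof.
  intros (_ & _ & _ & Hi & L0 & L1) x.
  apply is_lim_spec in L0. apply is_lim_spec in L1. simpl in L0, L1.
  split.
  - destruct (Rlt_le_dec 0 (U x)) as [H|H]; [exact H|exfalso].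
    pose proof (Hi (x - 1) x ltac:(lra)) as H1.
    assert (Pe : 0 < - U (x - 1)) by lra.
    destruct (L0 (mkposreal _ Pe)) as (M & HM). simpl in HM.
    set (z := Rmin (M - 1) (x - 2)).
    pose proof (Rmin_l (M - 1) (x - 2)). pose proof (Rmin_r (M - 1) (x - 2)).
    specialize (HM z ltac:(unfold z; lra)). apply Rabs_def2 in HM.
    pose proof (Hi z (x - 1) ltac:(unfold z; lra)). lra.
  - destruct (Rlt_le_dec (U x) 1) as [H|H]; [exact H|exfalso].
    pose proof (Hi x (x + 1) ltac:(lra)) as H1.
    assert (Pe : 0 < U (x + 1) - 1) by lra.
    destruct (L1 (mkposreal _ Pe)) as (M & HM). simpl in HM.
    set (z := Rmax (M + 1) (x + 2)).
    pose proof (Rmax_l (M + 1) (x + 2)). pose proof (Rmax_r (M + 1) (x + 2)).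
    specialize (HM z ltac:(unfold z; lra)). apply Rabs_def2 in HM.
    pose proof (Hi (x + 1) z ltac:(unfold z; lra)). lra.
Qed.

Lemma front_ext_f (f f' g : R -> R) (a b : R) (U U1 U2 : R -> R) :
  (forall u, 0 < u < 1 -> f u = f' u) ->
  front f g a b U U1 U2 -> front f' g a b U U1 U2.
Proof.
  intros E F. pose proof (front_range _ _ _ _ _ _ _ F) as Rg.
  destruct F as (H1 & H2 & He & H). refine (conj H1 (conj H2 (conj _ H))).
  intros x. rewrite <- E by apply Rg. apply He.
Qed.

(** The reflection [x -> - x], [U -> 1 - U] changes the sign of the speed. *)
Lemma front_reflect (f f' g g' : R -> R) (a b : R) (U U1 U2 : R -> R) :
  (forall u, f' u = - f (1 - u)) -> (forall u, g' u = g (1 - u)) ->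
  front f' g' a b U U1 U2 ->
  front f g a (- b) (fun x => 1 - U (- x)) (fun x => U1 (- x)) (fun x => - U2 (- x)).
Proof.
  intros Ef Eg (H1 & H2 & He & Hi & L0 & L1).
  refine (conj _ (conj _ (conj _ (conj _ (conj _ _))))).
  - intros x. replace (U1 (- x)) with (0 - (- 1) * U1 (- x)) by ring.
    apply is_derive_sub; [apply is_derive_cst|].
    apply (is_derive_comp U Ropp); [apply H1|]. auto_derive; [exact I|ring].
  - intros x. replace (- U2 (- x)) with ((- 1) * U2 (- x)) by ring.
    apply (is_derive_comp U1 Ropp); [apply H2|]. auto_derive; [exact I|ring].
  - intros x. specialize (He (- x)). rewrite Ef, Eg in He. lra.
  - intros x y Hxy. specialize (Hi (- y) (- x) ltac:(lra)). lra.
  - apply is_lim_spec. apply is_lim_spec in L1. simpl in *.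
    intros eps. destruct (L1 eps) as (M & HM). exists (- M). intros x Hx.
    specialize (HM (- x) ltac:(lra)). rewrite <- Rabs_Ropp.
    now replace (- (1 - U (- x) - 0)) with (U (- x) - 1) by ring.
  - apply is_lim_spec. apply is_lim_spec in L0. simpl in *.
    intros eps. destruct (L0 eps) as (M & HM). exists (- M). intros x Hx.
    specialize (HM (- x) ltac:(lra)). rewrite <- Rabs_Ropp.
    now replace (- (1 - U (- x) - 1)) with (U (- x) - 0) by ring.
Qed.

(** Rescaling [x -> k x] divides the diffusion by [k ^ 2] and the coefficient of
    the damping by [k]. *)
Lemma front_scale (f g : R -> R) (a b k : R) (U U1 U2 : R -> R) :
  0 < k ->
  front f g (a * k ^ 2) (b * k) U U1 U2 ->
  front f g a b (fun x => U (k * x)) (fun x => k * U1 (k * x))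
    (fun x => k ^ 2 * U2 (k * x)).
Proof.
  intros Hk (H1 & H2 & He & Hi & L0 & L1).
  assert (Dk : forall x, is_derive (fun t => k * t) x k)
    by (intros x; auto_derive; [exact I|ring]).
  refine (conj _ (conj _ (conj _ (conj _ (conj _ _))))).
  - intros x. apply (is_derive_comp U (fun t => k * t)); auto.
  - intros x. replace (k ^ 2 * U2 (k * x)) with (k * (k * U2 (k * x))) by ring.
    apply (is_derive_scal (fun t => U1 (k * t))).
    apply (is_derive_comp U1 (fun t => k * t)); auto.
  - intros x. specialize (He (k * x)). simpl in He. lra.
  - intros x y Hxy. apply Hi. now apply Rmult_lt_compat_l.
  - apply is_lim_spec. apply is_lim_spec in L0. simpl in *.
    intros eps. destruct (L0 eps) as (M & HM). exists (M / k). intros x Hx.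
    apply HM. apply Rmult_lt_reg_r with (/ k); [now apply Rinv_0_lt_compat|].
    replace (k * x * / k) with x by (field; lra). exact Hx.
  - apply is_lim_spec. apply is_lim_spec in L1. simpl in *.
    intros eps. destruct (L1 eps) as (M & HM). exists (M / k). intros x Hx.
    apply HM. apply Rmult_lt_reg_r with (/ k); [now apply Rinv_0_lt_compat|].
    replace (k * x * / k) with x by (field; lra). exact Hx.
Qed.

(** What the argument uses of a bistable [f] and of a damping coefficient [g] at
    fixed time. Both are continuous on the whole line, and [f] is dominated
    near each of its zeros by the distance to that zero; the signs of the
    derivatives of [f] at the zeros play no role. *)
Record bistable_data (f g : R -> R) (alpha delta K : R) : Prop := {
  bd_f : forall x, continuous f x;
  bd_g : forall x, continuous g x;
  bd_delta : 0 < delta;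
  bd_gdelta : forall x, delta <= g x;
  bd_alpha : 0 < alpha < 1;
  bd_neg : forall u, 0 < u < alpha -> f u < 0;
  bd_pos : forall u, alpha < u < 1 -> 0 < f u;
  bd_lip0 : forall u, 0 <= u <= 1 -> Rabs (f u) <= K * Rabs u;
  bd_lipa : forall u, 0 <= u <= 1 -> Rabs (f u) <= K * Rabs (u - alpha);
  bd_lip1 : forall u, 0 <= u <= 1 -> Rabs (f u) <= K * Rabs (u - 1)
}.

Lemma bistable_data_reflect (f g : R -> R) (alpha delta K : R) :
  bistable_data f g alpha delta K ->
  bistable_data (fun u => - f (1 - u)) (fun u => g (1 - u)) (1 - alpha) delta K.
Proof.
  intros [Hf Hg Hde Hgd Hal Hn Hp L0 La L1].
  assert (Hr : forall x, continuous (fun u : R => 1 - u) x).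
  { intros x. apply continuous_sub; [apply continuous_const|apply continuous_id]. }
  constructor; auto.
  - intros x. apply (continuous_opp (fun u => f (1 - u))).
    now apply (continuous_comp (fun u => 1 - u) f).
  - intros x. now apply (continuous_comp (fun u => 1 - u) g).
  - lra.
  - intros u Hu. specialize (Hp (1 - u)). lra.
  - intros u Hu. specialize (Hn (1 - u)). lra.
  - intros u Hu. rewrite Rabs_Ropp, <- (Rabs_Ropp u).
    replace (- u) with (1 - u - 1) by ring. apply L1. lra.
  - intros u Hu. rewrite Rabs_Ropp, Rabs_minus_sym.
    replace (1 - alpha - u) with (1 - u - alpha) by ring. apply La. lra.
  - intros u Hu. rewrite Rabs_Ropp, Rabs_minus_sym. apply L0. lra.
Qed.

Lemma bistable_data_K (f g : R -> R) (alpha delta K : R) :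
  bistable_data f g alpha delta K -> 0 <= K.
Proof.
  intros [_ _ _ _ _ _ _ L0 _ _]. specialize (L0 1 ltac:(lra)).
  rewrite Rabs_R1 in L0. pose proof (Rabs_pos (f 1)). lra.
Qed.

(** * Existence of a parabolic front *)

Lemma slope_derive (f g : R -> R) (gamma u : R) (y : R -> R) :
  phase_solution f g gamma y -> 0 < u < 1 -> 0 < y u ->
  is_derive (fun u => sqrt (y u)) u (- gamma * g u - f u / sqrt (y u)).
Proof.
  intros (_ & _ & Hd) Hu Hy. pose proof (sqrt_lt_R0 _ Hy).
  replace (- gamma * g u - f u / sqrt (y u)) with
    ((- 2 * f u - 2 * gamma * g u * sqrt (y u)) / (2 * sqrt (y u)))
    by (field; lra).
  apply is_derive_sqrt; auto.
Qed.

(** The slope [p = sqrt y] is bounded by a multiple of the distance to the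
    rest states, so that [1 / p] is not integrable at either of them. *)
Lemma slope_linear_bound (f g : R -> R) (alpha delta K gamma : R) (y : R -> R) :
  bistable_data f g alpha delta K ->
  phase_solution f g gamma y -> y 1 = 0 -> (forall u, 0 < u < 1 -> 0 < y u) ->
  exists A, 0 < A /\
    (forall u, 0 < u < 1 -> sqrt (y u) <= A * u) /\
    (forall u, 0 < u < 1 -> sqrt (y u) <= A * (1 - u)).
Proof.
  intros HB S H1 Hpos. pose proof (bistable_data_K _ _ _ _ _ HB) as K0.
  destruct (continuous_bounded_01 g (bd_g _ _ _ _ _ HB)) as (G & PG & HG).
  set (A := Rabs gamma * G + K + 1).
  assert (HA : 1 <= A) by (unfold A; pose proof (Rabs_pos gamma); nra).
  assert (Cs : forall x, continuous (fun u => sqrt (y u)) x).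
  { intros x. apply continuous_sqrt_comp. apply S. }
  assert (Hg : forall u, 0 < u < 1 -> Rabs (- gamma * g u) <= Rabs gamma * G).
  { intros u Hu. rewrite Rabs_mult, Rabs_Ropp.
    apply Rmult_le_compat_l; [apply Rabs_pos|]. apply HG. lra. }
  assert (Hq : forall u v, 0 < u < 1 -> 0 < v -> Rabs (f u) <= K * v ->
             A * v < sqrt (y u) -> Rabs (f u / sqrt (y u)) <= K).
  { intros u v Hu Hv Hf Hs. assert (Ps : 0 < sqrt (y u)) by nra.
    unfold Rdiv. rewrite Rabs_mult, Rabs_inv, (Rabs_pos_eq (sqrt (y u))) by lra.
    apply Rmult_le_reg_r with (sqrt (y u)); [exact Ps|].
    rewrite Rmult_assoc, Rinv_l by lra.
    assert (K * v <= K * sqrt (y u)) by (apply Rmult_le_compat_l; nra). lra. }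
  (* Where p exceeds A u, f / p is bounded by K, hence p' <= A. *)
  exists A. split; [lra|split].
  - intros u Hu. assert (H : sqrt (y u) - A * u <= 0); [|lra].
    apply (barrier (fun u => sqrt (y u) - A * u)
             (fun u => (- gamma * g u - f u / sqrt (y u)) - A) 0 u).
    + lra.
    + intros x _. apply continuous_sub; [apply Cs|].
      apply continuous_mul; [apply continuous_const|apply continuous_id].
    + intros x Hx. apply is_derive_sub.
      * apply slope_derive; [exact S|lra|apply Hpos; lra].
      * auto_derive; [exact I|ring].
    + intros x Hx Hp.
      pose proof (bd_lip0 _ _ _ _ _ HB x ltac:(lra)) as B1.
      rewrite (Rabs_pos_eq x) in B1 by lra.
      pose proof (Hq x x ltac:(lra) ltac:(lra) B1 ltac:(lra)) as B2.
      pose proof (Hg x ltac:(lra)) as B3. apply Rabs_le_between in B2, B3.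
      unfold A. lra.
    + destruct S as (_ & -> & _). rewrite sqrt_0. lra.
  - intros u Hu. assert (H : sqrt (y u) - A * (1 - u) <= 0); [|lra].
    apply (barrier_back (fun u => sqrt (y u) - A * (1 - u))
             (fun u => (- gamma * g u - f u / sqrt (y u)) - - A) u 1).
    + lra.
    + intros x _. apply continuous_sub; [apply Cs|].
      apply continuous_mul; [apply continuous_const|].
      apply continuous_sub; [apply continuous_const|apply continuous_id].
    + intros x Hx. apply is_derive_sub.
      * apply slope_derive; [exact S|lra|apply Hpos; lra].
      * auto_derive; [exact I|ring].
    + intros x Hx Hp.
      pose proof (bd_lip1 _ _ _ _ _ HB x ltac:(lra)) as B1.
      rewrite Rabs_minus_sym, (Rabs_pos_eq (1 - x)) in B1 by lra.
      pose proof (Hq x (1 - x) ltac:(lra) ltac:(lra) B1 ltac:(lra)) as B2.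
      pose proof (Hg x ltac:(lra)) as B3. apply Rabs_le_between in B2, B3.
      unfold A. lra.
    + rewrite H1, sqrt_0. lra.
Qed.

Lemma locally_open_01 (u : R) : 0 < u < 1 -> locally u (fun v => 0 < v < 1).
Proof.
  intros Hu. apply (locally_interval _ u 0 1); simpl; tauto.
Qed.

(** Intermediate values for a function continuous on an interval only. *)
Lemma intermediate_value (w : R -> R) (a b z : R) :
  a < b -> (forall x, a <= x <= b -> continuous w x) -> w a < z < w b ->
  exists x, a <= x <= b /\ w x = z.
Proof.
  intros Hab Hw Hz.
  destruct (IVT_interv (fun x => w x - z) a b) as (x & Hx & E).
  - intros x Hx. apply continuity_pt_filterlim.
    apply continuous_sub; [now apply Hw|apply continuous_const].
  - exact Hab.
  - lra.
  - lra.
  - exists x. split; [exact Hx|lra].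
Qed.

(** The front is the inverse of the travel time [T u], the integral of
    [1 / p] from [1/2] to [u], where [p = sqrt y] is the slope. *)
Lemma front_of_phase_solution (f g : R -> R) (alpha delta K gamma : R) (y : R -> R) :
  bistable_data f g alpha delta K ->
  phase_solution f g gamma y -> y 1 = 0 -> (forall u, 0 < u < 1 -> 0 < y u) ->
  exists V V1 V2, front f g 1 gamma V V1 V2.
Proof.
  intros HB S H1 Hpos.
  destruct (slope_linear_bound f g alpha delta K gamma y HB S H1 Hpos)
    as (A & PA & B0 & B1).
  set (p := fun u => sqrt (y u)) in *.
  assert (Pp : forall u, 0 < u < 1 -> 0 < p u)
    by (intros u Hu; now apply sqrt_lt_R0, Hpos).
  assert (pc : forall u, continuous p u)
    by (intros u; apply continuous_sqrt_comp; apply S).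
  assert (ipc : forall u, 0 < u < 1 -> continuous (fun s => / p s) u).
  { intros u Hu. apply (continuous_comp p Rinv); [apply pc|].
    apply continuous_Rinv. specialize (Pp u Hu). lra. }
  set (T := fun u => RInt (fun s => / p s) (1 / 2) u).
  assert (T0 : T (1 / 2) = 0)
    by apply (RInt_point (V := R_CompleteNormedModule)).
  assert (Td : forall u, 0 < u < 1 -> is_derive T u (/ p u)).
  { intros u Hu. apply (is_derive_RInt (fun s => / p s) T (1 / 2) u); [|now apply ipc].
    apply filter_imp with (2 := locally_open_01 u Hu). intros b Hb.
    apply (RInt_correct (V := R_CompleteNormedModule)). apply (ex_RInt_continuous (V := R_CompleteNormedModule)).
    intros z Hz. apply ipc.
    pose proof (Rmin_glb_lt (1 / 2) b 0). pose proof (Rmax_lub_lt (1 / 2) b 1). lra. }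
  assert (Tc : forall u, 0 < u < 1 -> continuous T u).
  { intros u Hu. apply (ex_derive_continuous T). exists (/ p u). now apply Td. }
  assert (Tinc : forall u v, 0 < u < 1 -> 0 < v < 1 -> u < v -> T u < T v).
  { intros u v Hu Hv Huv.
    destruct (mean_value T (fun u => / p u) u v Huv) as (c & Hc & E).
    - intros x Hx. apply Tc. lra.
    - intros x Hx. apply Td. lra.
    - pose proof (Rinv_0_lt_compat _ (Pp c ltac:(lra))). nra. }
  (* The travel time diverges logarithmically at both ends. *)
  assert (Tlow : forall u, 0 < u <= 1 / 2 -> T u <= (ln u - ln (1 / 2)) / A).
  { intros u Hu. assert (H : T u - (ln u - ln (1 / 2)) / A <= 0); [|lra].
    apply (barrier_back (fun u => T u - (ln u - ln (1 / 2)) / A)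
             (fun u => / p u - / (A * u)) u (1 / 2)).
    - lra.
    - intros x Hx. apply continuous_sub; [apply Tc; lra|].
      apply (ex_derive_continuous (fun u => (ln u - ln (1 / 2)) / A)).
      auto_derive. lra.
    - intros x Hx. apply is_derive_sub; [apply Td; lra|].
      auto_derive; [lra|field; lra].
    - intros x Hx _. specialize (B0 x ltac:(lra)). specialize (Pp x ltac:(lra)).
      pose proof (Rinv_le_contravar _ _ Pp B0). lra.
    - rewrite T0. unfold Rdiv. rewrite Rminus_diag. lra. }
  assert (Tup : forall u, 1 / 2 <= u < 1 -> (ln (1 / 2) - ln (1 - u)) / A <= T u).
  { intros u Hu. assert (H : (ln (1 / 2) - ln (1 - u)) / A - T u <= 0); [|lra].
    apply (barrier (fun u => (ln (1 / 2) - ln (1 - u)) / A - T u)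
             (fun u => / (A * (1 - u)) - / p u) (1 / 2) u).
    - lra.
    - intros x Hx. apply continuous_sub; [|apply Tc; lra].
      apply (ex_derive_continuous (fun u => (ln (1 / 2) - ln (1 - u)) / A)).
      auto_derive. lra.
    - intros x Hx. apply is_derive_sub; [|apply Td; lra].
      auto_derive; [lra|field; lra].
    - intros x Hx _. specialize (B1 x ltac:(lra)). specialize (Pp x ltac:(lra)).
      pose proof (Rinv_le_contravar _ _ Pp B1). lra.
    - rewrite T0. replace (1 - 1 / 2) with (1 / 2) by lra.
      unfold Rdiv. rewrite Rminus_diag. lra. }
  assert (Tsurj : forall x, exists u, 0 < u < 1 /\ T u = x).
  { intros x. set (e := exp (- (A * (Rabs x + 1)))).
    pose proof (Rabs_pos x) as Px.
    assert (Pe : 0 < e) by apply exp_pos.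
    assert (e1 : e < 1).
    { rewrite <- exp_0. apply exp_increasing. nra. }
    assert (El : ln (1 / 2 * e) - ln (1 / 2) = - (A * (Rabs x + 1))).
    { rewrite ln_mult by lra. unfold e. rewrite ln_exp. ring. }
    pose proof (Tlow (1 / 2 * e) ltac:(lra)) as I1.
    pose proof (Tup (1 - 1 / 2 * e) ltac:(lra)) as I2.
    replace (1 - (1 - 1 / 2 * e)) with (1 / 2 * e) in I2 by ring.
    replace (ln (1 / 2) - ln (1 / 2 * e)) with (A * (Rabs x + 1)) in I2 by lra.
    rewrite El in I1.
    replace (- (A * (Rabs x + 1)) / A) with (- (Rabs x + 1)) in I1 by (field; lra).
    replace (A * (Rabs x + 1) / A) with (Rabs x + 1) in I2 by (field; lra).
    pose proof (Rabs_le_between x (Rabs x)) as [Hx _]. specialize (Hx (Rle_refl _)).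
    destruct (intermediate_value T (1 / 2 * e) (1 - 1 / 2 * e) x) as (u & Hu & Eu).
    - lra.
    - intros t Ht. apply Tc. lra.
    - lra.
    - exists u. split; [lra|exact Eu]. }
  pose (sV := fun x => constructive_indefinite_description _ (Tsurj x)).
  set (V := fun x => proj1_sig (sV x)).
  assert (VR : forall x, 0 < V x < 1) by (intros x; apply (proj2_sig (sV x))).
  assert (TV : forall x, T (V x) = x) by (intros x; apply (proj2_sig (sV x))).
  assert (VT : forall u, 0 < u < 1 -> True /\ V (T u) = u).
  { intros u Hu. split; [exact I|].
    destruct (Rtotal_order (V (T u)) u) as [H|[H|H]]; [|exact H|].
    - pose proof (Tinc _ _ (VR (T u)) Hu H) as J. rewrite TV in J. lra.
    - pose proof (Tinc _ _ Hu (VR (T u)) H) as J. rewrite TV in J. lra. }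
  assert (VE : forall x, True -> 0 < V x < 1 /\ T (V x) = x) by auto.
  assert (Vinc : strict_increasing V).
  { intros x x' Hx.
    now apply (inverse_increasing (fun u => 0 < u < 1) (fun _ => True) T V VE Tinc). }
  assert (Vd : forall x, is_derive V x (p (V x))).
  { intros x. pose proof (Pp _ (VR x)) as P. rewrite <- (Rinv_inv (p (V x))).
    apply (is_derive_inverse (fun u => 0 < u < 1) (fun _ => True) T V); auto.
    - now apply locally_open_01.
    - now apply filter_forall.
    - pose proof (Rinv_0_lt_compat _ P). lra. }
  exists V, (fun x => p (V x)),
    (fun x => p (V x) * (- gamma * g (V x) - f (V x) / p (V x))).
  refine (conj Vd (conj _ (conj _ (conj Vinc (conj _ _))))).
  - intros x. apply (is_derive_comp p V); [|apply Vd].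
    apply slope_derive; auto.
  - intros x. pose proof (Pp _ (VR x)). field. lra.
  - apply is_lim_spec. intros eps. simpl.
    set (u := Rmin eps (1 / 2)).
    pose proof (Rmin_l eps (1 / 2)) as J1. pose proof (Rmin_r eps (1 / 2)) as J2.
    assert (Pu : 0 < u) by (apply Rmin_glb_lt; [apply cond_pos|lra]).
    exists (T u). intros x Hx. apply Vinc in Hx.
    rewrite (proj2 (VT u ltac:(unfold u in *; lra))) in Hx. specialize (VR x).
    apply Rabs_def1; unfold u in *; lra.
  - apply is_lim_spec. intros eps. simpl.
    set (u := Rmin eps (1 / 2)).
    pose proof (Rmin_l eps (1 / 2)) as J1. pose proof (Rmin_r eps (1 / 2)) as J2.
    assert (Pu : 0 < u) by (apply Rmin_glb_lt; [apply cond_pos|lra]).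
    exists (T (1 - u)). intros x Hx. apply Vinc in Hx.
    rewrite (proj2 (VT (1 - u) ltac:(unfold u in *; lra))) in Hx. specialize (VR x).
    apply Rabs_def1; unfold u in *; lra.
Qed.

Lemma RInt_reflect (f : R -> R) :
  (forall x, continuous f x) -> RInt (fun u => - f (1 - u)) 0 1 = - RInt f 0 1.
Proof.
  intros Hf.
  assert (Hex : forall a b, ex_RInt f a b)
    by (intros; apply (ex_RInt_continuous (V := R_CompleteNormedModule)); auto).
  rewrite <- (opp_RInt_swap f 1 0) by apply Hex.
  pose proof (RInt_comp_lin f (- 1) 1 0 1) as E.
  replace (- 1 * 0 + 1) with 1 in E by ring.
  replace (- 1 * 1 + 1) with 0 in E by ring.
  specialize (E (Hex _ _)). unfold opp; simpl. rewrite Ropp_involutive, <- E.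
  apply RInt_ext. intros u _. unfold scal; simpl; unfold mult; simpl.
  replace (- 1 * u + 1) with (1 - u) by ring. ring.
Qed.

(** Up to a reflection, which changes the sign of [gamma], the integral of
    [f] is nonpositive. *)
Lemma front_exists (f g : R -> R) (alpha delta K : R) :
  bistable_data f g alpha delta K ->
  exists gamma V V1 V2, front f g 1 gamma V V1 V2.
Proof.
  assert (W : forall f g alpha, bistable_data f g alpha delta K -> RInt f 0 1 <= 0 ->
            exists gamma V V1 V2, front f g 1 gamma V V1 V2).
  { clear. intros f g alpha HB HI.
    destruct (phase_connection_exists f g alpha delta) as (gamma & y & S & H1 & Hp);
      try apply HB; auto.
    exists gamma. now apply (front_of_phase_solution f g alpha delta K gamma y). }
  intros HB. destruct (Rle_lt_dec (RInt f 0 1) 0) as [HI|HI].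
  - now apply (W f g alpha).
  - destruct (W (fun u => - f (1 - u)) (fun u => g (1 - u)) (1 - alpha))
      as (gamma & V & V1 & V2 & F).
    + now apply bistable_data_reflect.
    + rewrite RInt_reflect by apply HB. lra.
    + exists (- gamma), (fun x => 1 - V (- x)), (fun x => V1 (- x)), (fun x => - V2 (- x)).
      now apply (front_reflect f _ g _) with (3 := F).
Qed.

(** * Uniqueness of the parabolic speed *)

Lemma increasing_derive_nonneg (U : R -> R) (x l : R) :
  strict_increasing U -> is_derive U x l -> 0 <= l.
Proof.
  intros Hi Hd. destruct (Rle_lt_dec 0 l) as [H|H]; [exact H|exfalso].
  apply is_derive_Reals in Hd. destruct (Hd (- l) ltac:(lra)) as (r & Hr).
  pose proof (cond_pos r) as Pr.
  specialize (Hr (r / 2) ltac:(lra)). rewrite Rabs_pos_eq in Hr by lra.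
  specialize (Hr ltac:(lra)). apply Rabs_def2 in Hr.
  assert (0 < (U (x + r / 2) - U x) / (r / 2)); [|lra].
  apply Rdiv_lt_0_compat; [|lra]. pose proof (Hi x (x + r / 2) ltac:(lra)). lra.
Qed.

(** The slope of a front vanishes nowhere: where it does, [U = alpha] and
    [U' = 0], hence [U] is constant by a Gronwall estimate. *)
Lemma front_slope_pos (f g : R -> R) (alpha delta K gamma : R) (U U1 U2 : R -> R) :
  bistable_data f g alpha delta K -> front f g 1 gamma U U1 U2 ->
  forall x, 0 < U1 x.
Proof.
  intros HB F x0. pose proof (front_range _ _ _ _ _ _ _ F) as Rg.
  pose proof (bistable_data_K _ _ _ _ _ HB) as K0.
  destruct F as (H1 & H2 & He & Hi & _ & _).
  assert (N : forall x, 0 <= U1 x)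
    by (intros x; now apply (increasing_derive_nonneg U x)).
  destruct (N x0) as [H|Hz]; [exact H|exfalso].
  assert (Z2 : U2 x0 = 0).
  { assert (pr : derivable_pt U1 x0) by (exists (U2 x0); now apply is_derive_Reals).
    rewrite <- (derive_pt_eq_0 U1 x0 (U2 x0) pr) by now apply is_derive_Reals.
    apply (deriv_minimum U1 (x0 - 1) (x0 + 1)); try lra.
    intros x _ _. rewrite <- Hz. apply N. }
  assert (Ua : U x0 = alpha).
  { pose proof (He x0) as E. rewrite Z2, <- Hz in E.
    pose proof (bd_neg _ _ _ _ _ HB (U x0)). pose proof (bd_pos _ _ _ _ _ HB (U x0)).
    specialize (Rg x0). destruct (Rtotal_order (U x0) alpha) as [C|[C|C]]; lra. }
  destruct (continuous_bounded_01 g (bd_g _ _ _ _ _ HB)) as (G & PG & HG).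
  set (C := 1 + 2 * Rabs gamma * G + 2 * K).
  assert (Uc : forall x, continuous U x).
  { intros x. apply (ex_derive_continuous U). exists (U1 x). apply H1. }
  assert (U1c : forall x, continuous U1 x).
  { intros x. apply (ex_derive_continuous U1). exists (U2 x). apply H2. }
  (* The energy (U - alpha)^2 + U'^2, damped by the Gronwall factor. *)
  pose (En := fun x => ((U x - alpha) ^ 2 + U1 x ^ 2) * exp (- C * (x - x0))).
  pose (dEn := fun x => (2 * (U x - alpha) * U1 x + 2 * U1 x * U2 x
                  - C * ((U x - alpha) ^ 2 + U1 x ^ 2)) * exp (- C * (x - x0))).
  assert (Ed : forall x, is_derive En x (dEn x)).
  { intros x. unfold En, dEn.
    assert (E1 : Derive (fun t => U t) x = U1 x) by apply is_derive_unique, H1.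
    assert (E2 : Derive (fun t => U1 t) x = U2 x) by apply is_derive_unique, H2.
    auto_derive.
    - split; [|split; [|exact I]]; eexists; [apply H1|apply H2].
    - rewrite E1, E2. unfold Rminus. ring. }
  assert (HE : En (x0 + 1) <= 0).
  { apply (barrier En dEn x0 (x0 + 1)); [lra| | | |].
    - intros x _. apply (ex_derive_continuous En). eexists. apply Ed.
    - intros x _. apply Ed.
    - intros x Hx _. unfold dEn.
      assert (Q : 2 * (U x - alpha) * U1 x + 2 * U1 x * U2 x
                  - C * ((U x - alpha) ^ 2 + U1 x ^ 2) <= 0).
      { pose proof (bd_lipa _ _ _ _ _ HB (U x) ltac:(specialize (Rg x); lra)) as L.
        pose proof (HG (U x) ltac:(specialize (Rg x); lra)) as LG.
        specialize (N x). specialize (He x).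
        assert (E2 : U2 x = - (gamma * g (U x)) * U1 x - f (U x)) by lra.
        set (z := U x - alpha) in *. set (v := U1 x) in *.
        assert (Lg : Rabs (gamma * g (U x)) <= Rabs gamma * G).
        { rewrite Rabs_mult. apply Rmult_le_compat_l; [apply Rabs_pos|exact LG]. }
        apply Rabs_le_between in Lg.
        assert (A1 : 2 * z * v <= z ^ 2 + v ^ 2)
          by (pose proof (pow2_ge_0 (z - v)); lra).
        assert (A2 : - f (U x) * v <= K * (z ^ 2 + v ^ 2)).
        { apply Rle_trans with (K * (Rabs z * v)).
          - apply Rle_trans with (Rabs (f (U x)) * v).
            + apply Rmult_le_compat_r; [exact N|]. rewrite <- Rabs_Ropp. apply Rle_abs.
            + rewrite <- Rmult_assoc. now apply Rmult_le_compat_r.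
          - apply Rmult_le_compat_l; [exact K0|].
            rewrite <- (pow2_abs z). pose proof (pow2_ge_0 (Rabs z - v)).
            pose proof (pow2_ge_0 (Rabs z)). pose proof (pow2_ge_0 v). lra. }
        assert (A3 : - (gamma * g (U x)) * v ^ 2 <= (Rabs gamma * G) * v ^ 2)
          by (apply Rmult_le_compat_r; [apply pow2_ge_0|lra]).
        assert (A4 : 0 <= (Rabs gamma * G) * z ^ 2)
          by (apply Rmult_le_pos; [lra|apply pow2_ge_0]).
        rewrite E2. unfold C. lra. }
      pose proof (exp_pos (- C * (x - x0))). nra.
    - unfold En. rewrite Ua, <- Hz. lra. }
  pose proof (Hi x0 (x0 + 1) ltac:(lra)) as HU. rewrite Ua in HU.
  unfold En in HE. pose proof (exp_pos (- C * (x0 + 1 - x0))) as Pe.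
  assert (0 < (U (x0 + 1) - alpha) ^ 2 + U1 (x0 + 1) ^ 2).
  { pose proof (pow2_ge_0 (U1 (x0 + 1))).
    assert (0 < (U (x0 + 1) - alpha) ^ 2) by (apply pow_lt; lra). lra. }
  nra.
Qed.

(** The slope of a front as a function [P] of its height: [P] solves
    [P' = - gamma g - f / P], and since the front is bounded its slope is not
    bounded away from [0] near either rest state. *)
Lemma front_slope_of_height (f g : R -> R) (alpha delta K gamma : R) (U U1 U2 : R -> R) :
  bistable_data f g alpha delta K -> front f g 1 gamma U U1 U2 ->
  exists P : R -> R,
    (forall u, 0 < u < 1 -> 0 < P u) /\
    (forall u, 0 < u < 1 -> is_derive P u (- gamma * g u - f u / P u)) /\
    (forall c s, 0 < c -> 0 < s < 1 -> exists u, 0 < u < s /\ P u < c) /\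
    (forall c s, 0 < c -> 0 < s < 1 -> exists u, s < u < 1 /\ P u < c).
Proof.
  intros HB F. pose proof (front_range _ _ _ _ _ _ _ F) as Rg.
  pose proof (front_slope_pos _ _ _ _ _ _ _ _ _ HB F) as Pos.
  destruct F as (H1 & H2 & He & Hi & L0 & L1).
  assert (Uc : forall x, continuous U x).
  { intros x. apply (ex_derive_continuous U). exists (U1 x). apply H1. }
  assert (Surj : forall u, exists x, 0 < u < 1 -> U x = u).
  { intros u. destruct (Rlt_le_dec 0 u) as [C0|C0]; [|exists 0; lra].
    destruct (Rlt_le_dec u 1) as [C1|C1]; [|exists 0; lra].
    apply is_lim_spec in L0. apply is_lim_spec in L1. simpl in L0, L1.
    destruct (L0 (mkposreal u C0)) as (M0 & HM0).
    assert (C1' : 0 < 1 - u) by lra.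
    destruct (L1 (mkposreal _ C1')) as (M1 & HM1). simpl in HM0, HM1.
    pose proof (Rmin_l (M0 - 1) (M1 - 1)) as R1. pose proof (Rmin_r (M0 - 1) (M1 - 1)) as R2.
    specialize (HM0 (Rmin (M0 - 1) (M1 - 1)) ltac:(lra)). apply Rabs_def2 in HM0.
    specialize (HM1 (M1 + 1) ltac:(lra)). apply Rabs_def2 in HM1.
    destruct (intermediate_value U (Rmin (M0 - 1) (M1 - 1)) (M1 + 1) u) as (x & _ & E).
    - lra.
    - intros x _. apply Uc.
    - lra.
    - now exists x. }
  pose (sk := fun u => constructive_indefinite_description _ (Surj u)).
  set (k := fun u => proj1_sig (sk u)).
  assert (UK : forall u, 0 < u < 1 -> True /\ U (k u) = u).
  { intros u Hu. split; [exact I|]. now apply (proj2_sig (sk u)). }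
  assert (KU : forall x, True -> 0 < U x < 1 /\ k (U x) = x).
  { intros x _. split; [apply Rg|].
    pose proof (proj2 (UK _ (Rg x))) as E.
    destruct (Rtotal_order (k (U x)) x) as [H|[H|H]]; [|exact H|];
      apply Hi in H; lra. }
  assert (Kd : forall u, 0 < u < 1 -> is_derive k u (/ U1 (k u))).
  { intros u Hu. pose proof (Pos (k u)).
    apply (is_derive_inverse (fun _ => True) (fun u => 0 < u < 1) U k); auto.
    - now apply filter_forall.
    - now apply locally_open_01.
    - lra. }
  exists (fun u => U1 (k u)). refine (conj _ (conj _ (conj _ _))).
  - intros u _. apply Pos.
  - intros u Hu.
    replace (- gamma * g u - f u / U1 (k u)) with (/ U1 (k u) * U2 (k u)).
    + apply (is_derive_comp U1 k); auto.
    + pose proof (He (k u)) as E. rewrite (proj2 (UK u Hu)) in E.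
      replace (U2 (k u)) with (- (gamma * g u) * U1 (k u) - f u) by lra.
      field. pose proof (Pos (k u)). lra.
  (* Over a length 1 / c the front rises by less than 1, so its slope is less
     than c somewhere. *)
  - intros c s Hc Hs. set (x := k s).
    assert (Pi : 0 < / c) by now apply Rinv_0_lt_compat.
    destruct (mean_value U U1 (x - / c) x) as (t & Ht & E); [lra|auto|auto|].
    exists (U t). rewrite (proj2 (KU t I)).
    pose proof (Rg t). pose proof (Rg x). pose proof (Rg (x - / c)).
    split.
    + split; [lra|]. rewrite <- (proj2 (UK s Hs)). apply Hi. apply Ht.
    + replace (x - (x - / c)) with (/ c) in E by ring.
      apply Rmult_lt_reg_r with (/ c); [exact Pi|]. rewrite Rinv_r by lra. lra.
  - intros c s Hc Hs. set (x := k s).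
    assert (Pi : 0 < / c) by now apply Rinv_0_lt_compat.
    destruct (mean_value U U1 x (x + / c)) as (t & Ht & E); [lra|auto|auto|].
    exists (U t). rewrite (proj2 (KU t I)).
    pose proof (Rg t). pose proof (Rg x). pose proof (Rg (x + / c)).
    split.
    + split; [|lra]. rewrite <- (proj2 (UK s Hs)). apply Hi. apply Ht.
    + replace (x + / c - x) with (/ c) in E by ring.
      apply Rmult_lt_reg_r with (/ c); [exact Pi|]. rewrite Rinv_r by lra. lra.
Qed.

(** For [ga1 < ga2] the difference [w = P - Q] of the two slopes satisfies
    [w' = (ga2 - ga1) g + f w / (P Q)]. As [f < 0] on [(0, alpha)], a negative
    value of [w] there would persist up to [0], making [Q] bounded below near
    [0]; symmetrically [w] cannot be positive on [(alpha, 1)]. But [w] is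
    strictly increasing at [alpha]. *)
Lemma front_speed_not_lt (f g : R -> R) (alpha delta K ga1 ga2 : R)
    (U U1 U2 V V1 V2 : R -> R) :
  bistable_data f g alpha delta K ->
  front f g 1 ga1 U U1 U2 -> front f g 1 ga2 V V1 V2 -> ~ ga1 < ga2.
Proof.
  intros HB FU FV Hlt.
  destruct (front_slope_of_height _ _ _ _ _ _ _ _ _ HB FU) as (P & Pp & Pd & _ & P1).
  destruct (front_slope_of_height _ _ _ _ _ _ _ _ _ HB FV) as (Q & Qp & Qd & Q0 & _).
  pose (w := fun u => P u - Q u).
  pose (dw := fun u => (- ga1 * g u - f u / P u) - (- ga2 * g u - f u / Q u)).
  assert (wd : forall u, 0 < u < 1 -> is_derive w u (dw u))
    by (intros u Hu; apply is_derive_sub; auto).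
  assert (wc : forall u, 0 < u < 1 -> continuous w u).
  { intros u Hu. apply (ex_derive_continuous w). exists (dw u). now apply wd. }
  assert (dwE : forall u, 0 < u < 1 ->
            dw u = (ga2 - ga1) * g u + f u * w u * / (P u * Q u)).
  { intros u Hu. unfold dw, w. specialize (Pp u Hu). specialize (Qp u Hu).
    field. lra. }
  assert (ipq : forall u, 0 < u < 1 -> 0 < / (P u * Q u)).
  { intros u Hu. apply Rinv_0_lt_compat. apply Rmult_lt_0_compat; auto. }
  assert (gp : forall u, 0 < (ga2 - ga1) * g u).
  { intros u. pose proof (bd_delta _ _ _ _ _ HB). pose proof (bd_gdelta _ _ _ _ _ HB u).
    nra. }
  pose proof (bd_alpha _ _ _ _ _ HB) as Hal.
  assert (Hl : forall s, 0 < s < alpha -> 0 <= w s).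
  { intros s Hs. destruct (Rle_lt_dec 0 (w s)) as [H|H]; [exact H|exfalso].
    destruct (Q0 (- w s) s ltac:(lra) ltac:(lra)) as (u & Hu & Hq).
    (* P u > 0 forces w u > w s, yet w increases from u to s while negative. *)
    assert (Hw : w s < w u) by (unfold w at 2; specialize (Pp u ltac:(lra)); lra).
    set (m := Rmin 0 (w u)).
    pose proof (Rmin_l 0 (w u)) as M1. pose proof (Rmin_r 0 (w u)) as M2.
    assert (M3 : w s < m) by (apply Rmin_glb_lt; lra).
    fold m in M1, M2.
    assert (m - w s <= 0); [|lra].
    apply (barrier (fun t => m - w t) (fun t => 0 - dw t) u s).
    - lra.
    - intros t Ht. apply continuous_sub; [apply continuous_const|apply wc; lra].
    - intros t Ht. apply is_derive_sub; [apply is_derive_cst|apply wd; lra].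
    - intros t Ht Hp. rewrite dwE by lra.
      pose proof (bd_neg _ _ _ _ _ HB t ltac:(lra)).
      pose proof (ipq t ltac:(lra)). pose proof (gp t).
      assert (0 <= f t * w t) by nra. nra.
    - lra. }
  assert (Hr : forall s, alpha < s < 1 -> w s <= 0).
  { intros s Hs. destruct (Rle_lt_dec (w s) 0) as [H|H]; [exact H|exfalso].
    destruct (P1 (w s) s ltac:(lra) ltac:(lra)) as (u & Hu & Hq).
    assert (Hw : w u < w s) by (unfold w at 1; specialize (Qp u ltac:(lra)); lra).
    set (m := Rmax 0 (w u)).
    pose proof (Rmax_l 0 (w u)) as M1. pose proof (Rmax_r 0 (w u)) as M2.
    assert (M3 : m < w s) by (apply Rmax_lub_lt; lra).
    fold m in M1, M2.
    assert (w s - m <= 0); [|lra].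
    apply (barrier_back (fun t => w t - m) (fun t => dw t - 0) s u).
    - lra.
    - intros t Ht. apply continuous_sub; [apply wc; lra|apply continuous_const].
    - intros t Ht. apply is_derive_sub; [apply wd; lra|apply is_derive_cst].
    - intros t Ht Hp. rewrite dwE by lra.
      pose proof (bd_pos _ _ _ _ _ HB t ltac:(lra)).
      pose proof (ipq t ltac:(lra)). pose proof (gp t).
      assert (0 <= f t * w t) by nra. nra.
    - lra. }
  assert (fa : f alpha = 0).
  { pose proof (bd_lipa _ _ _ _ _ HB alpha ltac:(lra)) as L.
    rewrite Rminus_diag, Rabs_R0, Rmult_0_r in L.
    pose proof (Rabs_pos (f alpha)). destruct (Req_dec (f alpha) 0) as [E|E]; [exact E|].
    pose proof (Rabs_pos_lt _ E). lra. }
  (* w >= 0 to the left of alpha and w <= 0 to its right, but w' alpha > 0. *)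
  pose proof (wd alpha Hal) as D. pose proof (dwE alpha Hal) as E.
  rewrite fa in E. pose proof (gp alpha) as G.
  assert (Pd0 : 0 < dw alpha) by (rewrite E; lra).
  apply is_derive_Reals in D. destruct (D (dw alpha) Pd0) as (r & Hr').
  pose proof (cond_pos r) as Pr.
  set (h := Rmin (r / 2) (Rmin (alpha / 2) ((1 - alpha) / 2))).
  pose proof (Rmin_l (r / 2) (Rmin (alpha / 2) ((1 - alpha) / 2))) as N1.
  pose proof (Rmin_r (r / 2) (Rmin (alpha / 2) ((1 - alpha) / 2))) as N2.
  pose proof (Rmin_l (alpha / 2) ((1 - alpha) / 2)) as N3.
  pose proof (Rmin_r (alpha / 2) ((1 - alpha) / 2)) as N4.
  assert (Ph : 0 < h) by (repeat apply Rmin_glb_lt; lra).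
  fold h in N1, N2.
  pose proof (Hr' h ltac:(lra)) as D1. pose proof (Hr' (- h) ltac:(lra)) as D2.
  rewrite Rabs_Ropp in D2. rewrite (Rabs_pos_eq h) in D1, D2 by lra.
  specialize (D1 ltac:(lra)). specialize (D2 ltac:(lra)).
  apply Rabs_def2 in D1, D2.
  assert (Q1 : 0 < (w (alpha + h) - w alpha) / h) by lra.
  assert (Q2 : 0 < (w (alpha + - h) - w alpha) / - h) by lra.
  assert (w alpha < w (alpha + h)).
  { assert (H : 0 < (w (alpha + h) - w alpha) / h * h) by now apply Rmult_lt_0_compat.
    replace ((w (alpha + h) - w alpha) / h * h) with (w (alpha + h) - w alpha) in H
      by (field; lra). lra. }
  assert (w (alpha + - h) < w alpha).
  { assert (H' : 0 < (w (alpha + - h) - w alpha) / - h * h) by now apply Rmult_lt_0_compat.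
    replace ((w (alpha + - h) - w alpha) / - h * h) with (w alpha - w (alpha + - h)) in H'
      by (field; lra). lra. }
  pose proof (Hl (alpha + - h) ltac:(lra)). pose proof (Hr (alpha + h) ltac:(lra)).
  lra.
Qed.

Lemma front_speed_unique (f g : R -> R) (alpha delta K ga1 ga2 : R)
    (U U1 U2 V V1 V2 : R -> R) :
  bistable_data f g alpha delta K ->
  front f g 1 ga1 U U1 U2 -> front f g 1 ga2 V V1 V2 -> ga1 = ga2.
Proof.
  intros HB FU FV. destruct (Rtotal_order ga1 ga2) as [H|[H|H]]; [|exact H|]; exfalso.
  - exact (front_speed_not_lt _ _ _ _ _ _ _ _ _ _ _ _ _ HB FU FV H).
  - exact (front_speed_not_lt _ _ _ _ _ _ _ _ _ _ _ _ _ HB FV FU H).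
Qed.

(** * The hyperbolic front *)

(** A front with nonzero speed needs positive diffusion: if [a <= 0 < b], the
    equation forces [a U'' < 0] wherever [U > alpha], so that [a < 0] and [U] is
    strictly convex there, and a strictly convex increasing function is
    unbounded. The
    case [b < 0] follows by reflection. *)
Lemma front_diffusion_pos (f g : R -> R) (alpha delta K a b : R) (U U1 U2 : R -> R) :
  bistable_data f g alpha delta K -> front f g a b U U1 U2 -> b <> 0 -> 0 < a.
Proof.
  intros HB F Hb.
  assert (W : forall f g alpha b U U1 U2, bistable_data f g alpha delta K ->
            front f g a b U U1 U2 -> 0 < b -> 0 < a).
  { clear. intros f g alpha b U U1 U2 HB F Hb.
    pose proof (front_range _ _ _ _ _ _ _ F) as Rg.
    destruct F as (H1 & H2 & He & Hi & _ & L1).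
    destruct (Rlt_le_dec 0 a) as [H|Ha]; [exact H|exfalso].
    pose proof (bd_alpha _ _ _ _ _ HB) as Hal.
    apply is_lim_spec in L1. simpl in L1.
    assert (Pal : 0 < 1 - alpha) by lra.
    destruct (L1 (mkposreal _ Pal)) as (M & HM). simpl in HM.
    set (x1 := M + 1).
    assert (Hx1 : forall x, x1 <= x -> alpha < U x).
    { intros x Hx. specialize (HM x ltac:(unfold x1 in Hx; lra)).
      apply Rabs_def2 in HM. lra. }
    assert (N : forall x, 0 <= U1 x)
      by (intros x; now apply (increasing_derive_nonneg U x)).
    assert (Cx : forall x, x1 <= x -> a * U2 x < 0).
    { intros x Hx. specialize (Hx1 x Hx). specialize (He x). specialize (N x).
      pose proof (bd_pos _ _ _ _ _ HB (U x) ltac:(specialize (Rg x); lra)).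
      pose proof (bd_delta _ _ _ _ _ HB). pose proof (bd_gdelta _ _ _ _ _ HB (U x)).
      assert (0 <= b * g (U x) * U1 x) by (repeat apply Rmult_le_pos; lra).
      lra. }
    assert (Cv : forall x, x1 <= x -> 0 < U2 x).
    { intros x Hx. specialize (Cx x Hx). nra. }
    assert (U1c : forall x, continuous U1 x).
    { intros x. apply (ex_derive_continuous U1). exists (U2 x). apply H2. }
    assert (Uc : forall x, continuous U x).
    { intros x. apply (ex_derive_continuous U). exists (U1 x). apply H1. }
    assert (Inc : forall x x', x1 <= x -> x < x' -> U1 x < U1 x').
    { intros x x' Hx Hxx.
      destruct (mean_value U1 U2 x x') as (t & Ht & E); auto.
      specialize (Cv t ltac:(lra)). nra. }
    set (c := U1 (x1 + 1)).
    assert (Pc : 0 < c)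
      by (pose proof (Inc x1 (x1 + 1) ltac:(lra) ltac:(lra)); specialize (N x1); unfold c; lra).
    pose proof (Rinv_0_lt_compat _ Pc) as Pi.
    destruct (mean_value U U1 (x1 + 1) (x1 + 1 + / c)) as (t & Ht & E); auto; [lra|].
    pose proof (Inc (x1 + 1) t ltac:(lra) ltac:(lra)) as Hct. fold c in Hct.
    replace (x1 + 1 + / c - (x1 + 1)) with (/ c) in E by ring.
    pose proof (Rg (x1 + 1)). pose proof (Rg (x1 + 1 + / c)).
    assert (c * / c = 1) by (field; lra).
    nra. }
  destruct (Rtotal_order b 0) as [H|[H|H]]; [|contradiction|].
  - apply (W (fun u => - f (1 - u)) (fun u => g (1 - u)) (1 - alpha) (- b)
             (fun x => 1 - U (- x)) (fun x => U1 (- x)) (fun x => - U2 (- x))).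
    + now apply bistable_data_reflect.
    + apply (front_reflect _ f _ g); [| |exact F]; intros u; simpl;
        replace (1 - (1 - u)) with u by ring; ring.
    + lra.
  - exact (W _ _ _ _ _ _ _ HB F H).
Qed.

Lemma clamp_ext_continuous (f : R -> R) :
  (forall x, 0 <= x <= 1 -> continue_in f (fun u => 0 <= u <= 1) x) ->
  forall x, continuous (fun u => f (clamp u)) x.
Proof.
  intros Hf x. apply continuity_pt_filterlim. intros eps Heps.
  destruct (Hf (clamp x) (clamp_range x) eps Heps) as (r & Pr & Hr).
  exists r. split; [exact Pr|]. intros t [_ Ht]. simpl in *. unfold Rdist in *.
  destruct (Req_dec (clamp x) (clamp t)) as [E|E].
  - rewrite E, Rminus_diag, Rabs_R0. exact Heps.
  - apply Hr. split; [split; [apply clamp_range|exact E]|].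
    apply Rle_lt_trans with (2 := Ht). apply clamp_nonexpansive.
Qed.

Lemma D_in_zero_lipschitz (f d : R -> R) (D : R -> Prop) (M z : R) :
  D_in f d D z -> f z = 0 -> (forall u, D u -> Rabs (f u) <= M) ->
  exists K, 0 <= K /\ forall u, D u -> Rabs (f u) <= K * Rabs (u - z).
Proof.
  intros Hd Hz HM. destruct (Hd 1 Rlt_0_1) as (r & Pr & Hr).
  simpl in Hr. unfold Rdist in Hr.
  exists (Rabs (d z) + 1 + Rabs M / r).
  pose proof (Rabs_pos (d z)) as P1.
  assert (P2 : 0 <= Rabs M / r)
    by (apply Rmult_le_pos; [apply Rabs_pos|now apply Rlt_le, Rinv_0_lt_compat]).
  split; [lra|]. intros u Hu.
  destruct (Req_dec z u) as [<-|E].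
  - rewrite Hz, Rminus_diag, Rabs_R0. lra.
  - assert (Pu : 0 < Rabs (u - z)) by (apply Rabs_pos_lt; lra).
    destruct (Rlt_le_dec (Rabs (u - z)) r) as [C|C].
    + specialize (Hr u (conj (conj Hu E) C)). rewrite Hz, Rminus_0_r in Hr.
      apply Rle_trans with ((Rabs (d z) + 1) * Rabs (u - z)); [|nra].
      replace (f u) with (f u / (u - z) * (u - z)) by (field; lra).
      rewrite Rabs_mult. apply Rmult_le_compat_r; [lra|].
      replace (f u / (u - z)) with (d z + (f u / (u - z) - d z)) by ring.
      apply Rle_trans with (1 := Rabs_triang _ _). lra.
    + specialize (HM u Hu).
      apply Rle_trans with (Rabs M / r * r).
      * replace (Rabs M / r * r) with (Rabs M) by (field; lra).
        apply Rle_trans with (1 := HM), Rle_abs.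
      * nra.
Qed.

(** Fronts take their values in [(0, 1)], so [f] may be replaced by its
    continuous extension [f (clamp u)]. *)
Lemma bistable_has_data (f : R -> R) :
  bistable f -> exists alpha K, forall g delta,
    0 < delta -> (forall x, continuous g x) -> (forall x, delta <= g x) ->
    bistable_data (fun u => f (clamp u)) g alpha delta K.
Proof.
  intros (f1 & f2 & alpha & HC & Hal & f0 & fa & fe & _ & _ & _ & Hpos & Hneg).
  set (D := fun u => 0 <= u <= 1) in *.
  assert (Hd : forall x, D x -> D_in f f1 D x) by (intros x Hx; apply (HC x Hx)).
  assert (Hc : forall x, continuous (fun u => f (clamp u)) x).
  { apply clamp_ext_continuous. intros x Hx. apply (cont_deriv f f1), Hd, Hx. }
  destruct (continuous_bounded_01 _ Hc) as (M & _ & HM').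
  assert (HM : forall u, D u -> Rabs (f u) <= M).
  { intros u Hu. specialize (HM' u Hu). simpl in HM'. now rewrite clamp_id in HM'. }
  destruct (D_in_zero_lipschitz f f1 D M 0 (Hd 0 ltac:(unfold D; lra)) f0 HM) as (K0 & P0 & L0).
  destruct (D_in_zero_lipschitz f f1 D M alpha (Hd alpha ltac:(unfold D; lra)) fa HM) as (Ka & Pa & La).
  destruct (D_in_zero_lipschitz f f1 D M 1 (Hd 1 ltac:(unfold D; lra)) fe HM) as (K1 & P1 & L1).
  exists alpha, (K0 + Ka + K1). intros g delta Hde Hg Hgd.
  constructor; auto.
  - intros u Hu. rewrite clamp_id by lra. now apply Hneg.
  - intros u Hu. rewrite clamp_id by lra. now apply Hpos.
  - intros u Hu. rewrite clamp_id by lra. specialize (L0 u Hu).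
    rewrite Rminus_0_r in L0. pose proof (Rabs_pos u). nra.
  - intros u Hu. rewrite clamp_id by lra. specialize (La u Hu).
    pose proof (Rabs_pos (u - alpha)). nra.
  - intros u Hu. rewrite clamp_id by lra. specialize (L1 u Hu).
    pose proof (Rabs_pos (u - 1)). nra.
Qed.

(** The lower bound on the open time interval passes to its end points. *)
Lemma admissible_damping_section (g : R -> R -> R) (tau_m tau : R) :
  0 < tau_m -> admissible_damping tau_m g -> 0 <= tau <= tau_m ->
  exists delta, 0 < delta /\ (forall u, continuous (fun v => g v tau) u) /\
    forall u, delta <= g u tau.
Proof.
  intros Hm ((gu & gt & Hg & _) & delta & Hde & Hlow) Ht.
  exists delta. split; [exact Hde|split].
  - intros u. apply (ex_derive_continuous (fun v => g v tau)). exists (gu u tau).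
    apply (Hg u tau Ht).
  - intros u. destruct (Rle_lt_dec delta (g u tau)) as [H|H]; [exact H|exfalso].
    pose proof (cont_deriv _ _ _ _ (proj2 (Hg u tau Ht))) as Hc.
    destruct (Hc (delta - g u tau) ltac:(lra)) as (r & Pr & Hr).
    simpl in Hr. unfold Rdist in Hr.
    assert (Ex : exists s, 0 < s < tau_m /\ tau <> s /\ Rabs (s - tau) < r).
    { destruct (Rlt_le_dec tau tau_m) as [C|C].
      - pose proof (Rmin_l (r / 2) ((tau_m - tau) / 2)).
        pose proof (Rmin_r (r / 2) ((tau_m - tau) / 2)).
        assert (0 < Rmin (r / 2) ((tau_m - tau) / 2)) by (apply Rmin_glb_lt; lra).
        exists (tau + Rmin (r / 2) ((tau_m - tau) / 2)).
        split; [lra|split; [lra|]]. apply Rabs_def1; lra.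
      - pose proof (Rmin_l (r / 2) (tau_m / 2)).
        pose proof (Rmin_r (r / 2) (tau_m / 2)).
        assert (0 < Rmin (r / 2) (tau_m / 2)) by (apply Rmin_glb_lt; lra).
        exists (tau - Rmin (r / 2) (tau_m / 2)).
        split; [lra|split; [lra|]]. apply Rabs_def1; lra. }
    destruct Ex as (s & Hs & Hne & Hlt).
    specialize (Hr s (conj (conj (conj (Rlt_le _ _ (proj1 Hs)) (Rlt_le _ _ (proj2 Hs))) Hne) Hlt)).
    specialize (Hlow u s Hs). apply Rabs_def2 in Hr. lra.
Qed.

Theorem theorem1 (f : R -> R) (g : R -> R -> R) (tau_m tau : R)
    (htau_m : 0 < tau_m)
    (hf : bistable f)
    (hg : admissible_damping tau_m g)
    (htau : 0 <= tau <= tau_m) :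
  exists c_star : R,
    unique (hyperbolic_front_speed f g tau) c_star /\
    c_star = gamma_star f g tau / sqrt (1 + tau * gamma_star f g tau ^ 2).
Proof.
  destruct (admissible_damping_section g tau_m tau htau_m hg htau) as (delta & Hde & Hgc & Hgd).
  destruct (bistable_has_data f hf) as (alpha & K & HB).
  specialize (HB (fun u => g u tau) delta Hde Hgc Hgd).
  set (fc := fun u => f (clamp u)) in HB.
  assert (Efc : forall u, 0 < u < 1 -> fc u = f u)
    by (intros u Hu; unfold fc; rewrite clamp_id; [reflexivity|lra]).
  assert (Efc' : forall u, 0 < u < 1 -> f u = fc u) by (intros; symmetry; auto).
  destruct (front_exists _ _ _ _ _ HB) as (gamma & V & V1 & V2 & FV).
  assert (Hpar : unique (parabolic_front_speed f g tau) gamma).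
  { split.
    - exists V. apply front_is_front with V1 V2. exact (front_ext_f _ _ _ _ _ _ _ _ Efc FV).
    - intros gamma' (W & HW). apply is_front_front in HW.
      apply (front_ext_f _ _ _ _ _ _ _ _ Efc') in HW.
      exact (front_speed_unique _ _ _ _ _ _ _ _ _ _ _ _ _ HB FV HW). }
  assert (Hgs : gamma_star f g tau = gamma).
  { symmetry. apply Hpar. unfold gamma_star.
    apply (iota_correct (parabolic_front_speed f g tau)). now exists gamma. }
  (* With s the square root below, 1 - (gamma / s)^2 tau = 1 / s^2. *)
  rewrite Hgs. pose proof (pow2_ge_0 gamma) as Pg2.
  assert (Ps2 : 0 < 1 + tau * gamma ^ 2)
    by (assert (0 <= tau * gamma ^ 2) by (apply Rmult_le_pos; lra); lra).
  set (s := sqrt (1 + tau * gamma ^ 2)).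
  assert (Ps : 0 < s) by now apply sqrt_lt_R0.
  assert (Es : s ^ 2 = 1 + tau * gamma ^ 2) by (unfold s; apply pow2_sqrt; lra).
  exists (gamma / s). split; [split|reflexivity].
  - exists (fun x => V (s * x)).
    apply front_is_front with (fun x => s * V1 (s * x)) (fun x => s ^ 2 * V2 (s * x)).
    apply (front_ext_f fc f); [exact Efc|].
    apply front_scale; [exact Ps|].
    replace ((1 - (gamma / s) ^ 2 * tau) * s ^ 2) with (s ^ 2 - tau * gamma ^ 2)
      by (field; lra).
    replace (gamma / s * s) with gamma by (field; lra).
    rewrite Es. replace (1 + tau * gamma ^ 2 - tau * gamma ^ 2) with 1 by ring.
    exact FV.
  - intros c (W & HW). apply is_front_front in HW.
    apply (front_ext_f _ _ _ _ _ _ _ _ Efc') in HW.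
    set (a := 1 - c ^ 2 * tau) in *.
    assert (Pa : 0 < a).
    { destruct (Req_dec c 0) as [->|Hc].
      - unfold a. lra.
      - exact (front_diffusion_pos _ _ _ _ _ _ _ _ _ _ HB HW Hc). }
    assert (Pr : 0 < sqrt a) by now apply sqrt_lt_R0.
    assert (Er : sqrt a ^ 2 = a) by (apply pow2_sqrt; lra).
    assert (Eg : gamma = c / sqrt a).
    { eapply front_speed_unique; [exact HB|exact FV|].
      apply (front_scale _ _ 1 (c / sqrt a) (sqrt a) W (Derive W) (Derive (Derive W))); [exact Pr|].
      rewrite Er, Rmult_1_l. replace (c / sqrt a * sqrt a) with c by (field; lra).
      exact HW. }
    assert (Esa : s = / sqrt a).
    { unfold s. rewrite <- sqrt_inv. f_equal.
      rewrite Eg. unfold Rdiv. rewrite Rpow_mult_distr, pow_inv, Er.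
      unfold a. field. fold a. lra. }
    rewrite Esa, Eg. field. lra.
Qed.
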